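(* Let $\{\alpha,S_0,\vartheta_1,\vartheta_2\}$ be an admissible quadruple such that the pair $\{\alpha,\vartheta_1\}$ is controllable and $\mathrm{i}\notin\sigma(\alpha)$, and let $\{C_k\}_{k\ge0}$ be the potential generated by it. Then, for any $\varepsilon>0$, there is $\delta>0$ such that each potential $\{\widetilde C_k\}_{k\ge0}$ generated by an admissible quadruple $\{\widetilde\alpha,\widetilde S_0,\widetilde\vartheta_1,\widetilde\vartheta_2\}$ (with the same $n,m_1,m_2$) satisfying $$\|\alpha-\widetilde\alpha\|+\|S_0-\widetilde S_0\|+\|\vartheta_1-\widetilde\vartheta_1\|+\|\vartheta_2-\widetilde\vartheta_2\|<\delta$$ belongs to the $\varepsilon$-neighborhood of $\{C_k\}$, that is, $$\sup_{k\in\mathbb{N}_0}\|C_k-\widetilde C_k\|<\varepsilon.$$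
   Context: $\|\cdot\|$ is the $\ell^2$-induced matrix norm; $\sigma(\alpha)$ is the spectrum of $\alpha$; $\mathbb{N}_0=\{0,1,2,\dots\}$; $X>0$ means that $X$ is Hermitian with all eigenvalues positive. Let $m=m_1+m_2$, $j=\mathrm{diag}\{I_{m_1},-I_{m_2}\}$. A quadruple $\{\alpha,S_0,\vartheta_1,\vartheta_2\}$ of complex $n\times n$ matrices $\alpha,S_0$ and $n\times m_k$ matrices $\vartheta_k$ ($k=1,2$) is admissible if $S_0>0$ and $$\alpha S_0-S_0\alpha^*=\mathrm{i}(\vartheta_1\vartheta_1^*+\vartheta_2\vartheta_2^* ).$$ The pair $\{\alpha,\vartheta_1\}$ is controllable if $\mathrm{span}\bigcup_{k=0}^{n-1}\mathrm{Im}(\alpha^k\vartheta_1)=\mathbb{C}^n$. The potential $\{C_k\}_{k\ge 0}$ generated by the quadruple is the sequence of $m\times m$ matrices $$C_k=j+\Lambda_k^*S_k^{-1}\Lambda_k-\Lambda_{k+1}^*S_{k+1}^{-1}\Lambda_{k+1},$$ $$\Lambda_0=\begin{bmatrix}\vartheta_1&\vartheta_2\end{bmatrix},\quad \Lambda_{k+1}=\Lambda_k+\mathrm{i}\alpha^{-1}\Lambda_kj,\quad S_{k+1}=S_k+\alpha^{-1}S_k(\alpha^* )^{-1}+\alpha^{-1}\Lambda_kj\Lambda_k^*(\alpha^* )^{-1},$$ whenever $\alpha$ and all $S_k$ are invertible. (If the quadruple is admissible and $\{\alpha,\vartheta_1\}$ is controllable, then $\sigma(\alpha)$ lies in the open upper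 half-plane and all $S_k>0$, so the sequence is well defined.) *)

(* Defs.v *)
From HB Require Import structures.
From mathcomp Require Import all_boot all_order all_algebra.
From mathcomp Require Import sesquilinear spectral.
From mathcomp Require Import all_classical all_reals ereal.
From mathcomp Require Import complex.

Set Implicit Arguments.
Unset Strict Implicit.
Unset Printing Implicit Defensive.

Import Order.TTheory GRing.Theory Num.Theory.

Local Open Scope classical_set_scope.
Local Open Scope ring_scope.
Local Open Scope complex_scope.
Local Open Scope sesquilinear_scope.

Definition l2norm (R : realType) (n : nat) (v : 'cV[R[i]]_n) : R :=
  Num.sqrt (\sum_(k < n) (complex.Re (v k 0) ^+ 2 + complex.Im (v k 0) ^+ 2)).

(* The unit ball (rather than the unit sphere) keeps the set nonempty for
   n = 0. *)
Definition opnorm (R : realType) (p n : nat) (A : 'M[R[i]]_(p, n)) : R :=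
  sup [set l2norm (A *m v) | v in [set v : 'cV[R[i]]_n | l2norm v <= 1]].

(* Over R[i], 0 < a means that a is real and positive. *)
Definition posdefmx (R : realType) (n : nat) (X : 'M[R[i]]_n) : Prop :=
  X ^t* = X /\ forall a : R[i], eigenvalue X a -> 0 < a.

Definition sigma (R : realType) (n : nat) (A : 'M[R[i]]_n) : set R[i] :=
  [set a | eigenvalue A a].

Definition jmx (R : realType) (m1 m2 : nat) : 'M[R[i]]_(m1 + m2) :=
  block_mx 1%:M 0 0 (- 1%:M).

Definition admissible (R : realType) (n m1 m2 : nat) (alpha S0 : 'M[R[i]]_n)
    (th1 : 'M[R[i]]_(n, m1)) (th2 : 'M[R[i]]_(n, m2)) : Prop :=
  posdefmx S0 /\
  alpha *m S0 - S0 *m alpha ^t* = 'i *: (th1 *m th1 ^t* + th2 *m th2 ^t*).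

(* Row spaces of transposes are used to represent column spaces (images). *)
Definition controllable (R : realType) (n m1 : nat) (alpha : 'M[R[i]]_n)
    (th1 : 'M[R[i]]_(n, m1)) : Prop :=
  row_full (\sum_(k < n) <<(alpha ^+ k *m th1)^T>>)%MS.

Fixpoint Lambda (R : realType) (n m1 m2 : nat) (alpha : 'M[R[i]]_n)
    (th1 : 'M[R[i]]_(n, m1)) (th2 : 'M[R[i]]_(n, m2)) (k : nat) :
    'M[R[i]]_(n, m1 + m2) :=
  if k is k'.+1 then
    let L := Lambda alpha th1 th2 k' in
    L + 'i *: (invmx alpha *m L *m jmx R m1 m2)
  else row_mx th1 th2.

Fixpoint Smx (R : realType) (n m1 m2 : nat) (alpha S0 : 'M[R[i]]_n)
    (th1 : 'M[R[i]]_(n, m1)) (th2 : 'M[R[i]]_(n, m2)) (k : nat) : 'M[R[i]]_n :=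
  if k is k'.+1 then
    let S := Smx alpha S0 th1 th2 k' in
    let L := Lambda alpha th1 th2 k' in
    S + invmx alpha *m S *m invmx (alpha ^t*)
      + invmx alpha *m L *m jmx R m1 m2 *m L ^t* *m invmx (alpha ^t*)
  else S0.

(* invmx is total (invmx A = A for singular A).  This default value plays no
   role for admissible quadruples with alpha invertible and 'i outside the
   spectrum of alpha, since then
     S_(k+1) = (1 - 'i alpha^-1) S_k (1 - 'i alpha^-1)^*
               + alpha^-1 Lambda_k (1 + j) Lambda_k^* (alpha^-1)^*
   is positive definite along with S_k. *)
Definition potential (R : realType) (n m1 m2 : nat) (alpha S0 : 'M[R[i]]_n)
    (th1 : 'M[R[i]]_(n, m1)) (th2 : 'M[R[i]]_(n, m2)) (k : nat) :
    'M[R[i]]_(m1 + m2) :=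
  let L := Lambda alpha th1 th2 in
  let S := Smx alpha S0 th1 th2 in
  jmx R m1 m2 + (L k) ^t* *m invmx (S k) *m L k
              - (L k.+1) ^t* *m invmx (S k.+1) *m L k.+1.

(* Main.v *)
(* Write D = (alpha + i)^-1 (alpha - i) and A = 1 + i alpha^-1. Then
   Lambda_k = A^k [th1, D^k th2] and S_k = A^k Q_k (A^k)^*, where
     Q_(k+1) = Q_k - 2 (R D^k th2) (R D^k th2)^*
             = D Q_k D^* + 2 (R th1) (R th1)^*
   with R = (alpha + i)^-1, so that the factors A^k cancel:
     C_k = j + f_k - f_(k+1),  f_k = [th1, D^k th2]^* Q_k^-1 [th1, D^k th2].
   The two recursions bound all the Q_k below by the gramian
   2 sum_(k < n) (D^k R th1) (D^k R th1)^*, which is positive definite by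
   controllability, and show that D^n is a strict contraction for the norm given
   by S_0. Both bounds are stable under small perturbations. Hence
   f_k - f_(k+1) tends to 0 as k tends to infinity, uniformly for nearby
   quadruples, and the finitely many remaining indices are handled by the
   continuity of each f_k. *)
Require Import Defs.
From HB Require Import structures.
From mathcomp Require Import all_boot all_order all_algebra.
From mathcomp Require Import sesquilinear spectral.
From mathcomp Require Import all_classical all_reals ereal.
From mathcomp Require Import complex ring lra.

Set Implicit Arguments.
Unset Strict Implicit.
Unset Printing Implicit Defensive.

Import Order.TTheory GRing.Theory Num.Theory.

Local Open Scope classical_set_scope.
Local Open Scope ring_scope.
Local Open Scope sesquilinear_scope.

(** * Cayley transform and the reduced recursion *)

Section Adjoint.
Variable C : numClosedFieldType.

Lemma adjmxM p q r (A : 'M[C]_(p, q)) (B : 'M[C]_(q, r)) :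
  (A *m B) ^t* = B ^t* *m A ^t*.
Proof. by rewrite trmx_mul map_mxM. Qed.

Lemma adjmxD p q (A B : 'M[C]_(p, q)) : (A + B) ^t* = A ^t* + B ^t*.
Proof. by rewrite raddfD map_mxD. Qed.

Lemma adjmxB p q (A B : 'M[C]_(p, q)) : (A - B) ^t* = A ^t* - B ^t*.
Proof. by rewrite raddfB map_mxB. Qed.

Lemma adjmxZ p q a (A : 'M[C]_(p, q)) : (a *: A) ^t* = a^* *: A ^t*.
Proof. by rewrite linearZ map_mxZ. Qed.

Lemma adjmx_scalar n (a : C) : (a%:M : 'M_n) ^t* = a^*%:M.
Proof. by rewrite tr_scalar_mx map_scalar_mx. Qed.

End Adjoint.

Lemma invmx_mul (C : numClosedFieldType) n (A B : 'M[C]_n) :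
  A \in unitmx -> B \in unitmx -> invmx (A *m B) = invmx B *m invmx A.
Proof.
move=> uA uB; have uAB : A *m B \in unitmx by rewrite unitmx_mul uA.
apply: (can_inj (mulKmx uAB)).
by rewrite mulmxV// -mulmxA mulKVmx// mulmxV.
Qed.

Section Cayley.
Variables (C : numClosedFieldType) (n : nat).
Implicit Types a X : 'M[C]_n.

Definition resolvent a : 'M[C]_n := invmx (a + 'i%:M).
Definition cayley a : 'M[C]_n := resolvent a *m (a - 'i%:M).
Definition lyap a X : 'M[C]_n := a *m X - X *m a ^t*.

Lemma resolventC a : a + 'i%:M \in unitmx ->
  resolvent a *m a = a *m resolvent a.
Proof.
move=> ua.
have: resolvent a *m (a + 'i%:M) = (a + 'i%:M) *m resolvent a.
  by rewrite mulVmx // mulmxV.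
rewrite mulmxDr mulmxDl mul_scalar_mx mul_mx_scalar; exact: addIr.
Qed.

Lemma cayley_resolvent a : a + 'i%:M \in unitmx ->
  resolvent a *m cayley a = cayley a *m resolvent a.
Proof.
move=> ua; rewrite /cayley -!mulmxA; congr (_ *m _).
by rewrite mulmxBl mulmxBr mul_scalar_mx mul_mx_scalar resolventC.
Qed.


(** Both terms on the left are conjugates by [resolvent a], of (a + i) X (a + i)^* and of (a - i) X
    (a - i)^* . In their difference a X a^* and X cancel and only cross terms remain. This turns
    identities for [lyap] into one-step identities for the Cayley transform D. *)
Lemma cayley_lyap a X : a + 'i%:M \in unitmx ->
  X - cayley a *m X *m (cayley a) ^t* =
  (- 2 * 'i) *: (resolvent a *m lyap a X *m (resolvent a) ^t*).
Proof.
move=> ua.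
have eX : X = resolvent a *m
    ((a + 'i%:M) *m X *m (a + 'i%:M) ^t*) *m (resolvent a) ^t*.
  rewrite -!mulmxA -adjmxM mulVmx// adjmx_scalar conjC1 mulmx1.
  by rewrite mulKmx.
have -> : cayley a *m X *m (cayley a) ^t* = resolvent a *m
    ((a - 'i%:M) *m X *m (a - 'i%:M) ^t*) *m (resolvent a) ^t*.
  by rewrite adjmxM !mulmxA.
rewrite {1}eX -mulmxBl -mulmxBr scalemxAl scalemxAr; congr (_ *m _ *m _).
rewrite adjmxD adjmxB adjmx_scalar conjCi /lyap !(mulmxBl, mulmxDl).
rewrite !(mulmxBr, mulmxDr) !mul_scalar_mx !mul_mx_scalar -!scalemxAl.
move: (a *m X *m a ^t*) (a *m X) (X *m a ^t*) => U V W.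
by apply/matrixP => i j; rewrite !mxE; ring.
Qed.

Lemma lyapB a X Y : lyap a (X - Y) = lyap a X - lyap a Y.
Proof.
rewrite /lyap mulmxBr mulmxBl !opprB addrACA [RHS]addrACA.
by rewrite [- (X *m _) + _]addrC.
Qed.

Lemma lyapZ a c X : lyap a (c *: X) = c *: lyap a X.
Proof. by rewrite /lyap -scalemxAr -scalemxAl scalerBr. Qed.

Lemma lyap_resolvent a X : a + 'i%:M \in unitmx ->
  lyap a (resolvent a *m X *m (resolvent a) ^t*) =
  resolvent a *m lyap a X *m (resolvent a) ^t*.
Proof.
move=> ua; rewrite /lyap mulmxBr mulmxBl -!mulmxA -adjmxM.
by rewrite -resolventC// adjmxM !mulmxA resolventC.
Qed.

Section Recursion.
Variables (m1 m2 : nat) (a S0 : 'M[C]_n).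
Variables (b : 'M[C]_(n, m1)) (c : 'M[C]_(n, m2)).

(* [A^-k S_k (A^-k)^*] for [A = growth a], see [Smx_red]. *)
Fixpoint redS k : 'M[C]_n :=
  if k is k'.+1 then
    let v := cayley a ^+ k' *m c in
    redS k' - 2 *: (resolvent a *m (v *m v ^t*) *m (resolvent a) ^t*)
  else S0.

Hypothesis ua : a + 'i%:M \in unitmx.
Hypothesis lyap0 : lyap a S0 = 'i *: (b *m b ^t* + c *m c ^t*).

Lemma cayleyXS k : cayley a ^+ k.+1 *m c = cayley a *m (cayley a ^+ k *m c).
Proof. by rewrite exprS mulmxA. Qed.

(** The admissibility identity persists along the recursion: with v = D^k c, [cayley_lyap] at v v^*
    shows that the matrix subtracted from [redS k] trades v v^* for (D v) (D v)^* on the right. *)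
Lemma lyap_redS k : lyap a (redS k) =
  'i *: (b *m b ^t* + (cayley a ^+ k *m c) *m (cayley a ^+ k *m c) ^t*).
Proof.
elim: k => [|k IH]; first by rewrite expr0 mul1mx.
rewrite /= lyapB lyapZ lyap_resolvent// IH cayleyXS.
move: (cayley a ^+ k *m c) => v.
rewrite adjmxM -[in RHS]mulmxA [v *m (_ *m _)]mulmxA mulmxA.
have := cayley_lyap (v *m v ^t*) ua.
move: (v *m v ^t*) (b *m b ^t*) => V B.
move/(canRL (subrK _))/(canLR (addKr _)) => <-.
move: (_ *m _ *m _) => W.
apply/matrixP => i j; rewrite !mxE.
have i2 : 'i * 'i = -1 :> C by rewrite -expr2 sqrCi.
by ring: i2.
Qed.

(** By [cayley_lyap] and [lyap_redS], Q - D Q D^* for Q = [redS k] is twice the conjugate by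
    [resolvent a] of b b^* + v v^*. Moving the v term to the left gives this second form of the
    recursion, in which everything added is nonnegative. *)
Lemma redSS k : redS k.+1 =
  cayley a *m redS k *m (cayley a) ^t* +
  2 *: (resolvent a *m (b *m b ^t*) *m (resolvent a) ^t*).
Proof.
have /= /(canRL (subrK _)) {1}-> := cayley_lyap (redS k) ua.
rewrite lyap_redS -scalemxAr -scalemxAl mulmxDr mulmxDl.
move: (_ *m redS k *m _) (_ *m (b *m _) *m _) (_ *m (_ *m _) *m _) => X Y Z.
apply/matrixP => i j; rewrite !mxE.
have i2 : 'i * 'i = -1 :> C by rewrite -expr2 sqrCi.
by ring: i2.
Qed.

End Recursion.

(** One step of [Lambda] multiplies the first block of columns by this matrix and the second block
    by [growth a *m cayley a]. *)
Definition growth a : 'M[C]_n := 1%:M + 'i *: invmx a.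

Lemma growthE a : a \in unitmx -> growth a = invmx a *m (a + 'i%:M).
Proof. by move=> ua; rewrite mulmxDr mulVmx// mul_mx_scalar. Qed.

Lemma growth_unit a : a \in unitmx -> a + 'i%:M \in unitmx ->
  growth a \in unitmx.
Proof. by move=> ua uai; rewrite growthE// unitmx_mul unitmx_inv ua. Qed.

Lemma growth_resolvent a : a \in unitmx -> a + 'i%:M \in unitmx ->
  growth a *m resolvent a = invmx a.
Proof. by move=> ua uai; rewrite growthE// -mulmxA mulmxV// mulmx1. Qed.

Lemma growth_cayley a : a \in unitmx -> a + 'i%:M \in unitmx ->
  growth a *m cayley a = 1%:M - 'i *: invmx a.
Proof.
move=> ua uai; rewrite mulmxA growth_resolvent// mulmxBr mulVmx//.
by rewrite mul_mx_scalar.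
Qed.

Lemma growth_comm a : growth a *m invmx a = invmx a *m growth a.
Proof. by rewrite mulmxDl mulmxDr mulmx1 mul1mx -scalemxAl -scalemxAr. Qed.

Lemma growthX_comm a k : growth a ^+ k *m invmx a = invmx a *m growth a ^+ k.
Proof.
elim: k => [|k IH]; first by rewrite expr0 mulmx1 mul1mx.
by rewrite exprS -mulmxA IH !mulmxA growth_comm.
Qed.

(** Matches one step of [Smx]: the cross terms of the expansion contribute b b^* + v v^*, and
    subtracting 2 v v^* flips one sign, which accounts for the signature j. *)
Lemma growth_redS_step p q a Q (b : 'M[C]_(n, p)) (v : 'M[C]_(n, q)) :
  a \in unitmx -> a + 'i%:M \in unitmx ->
  lyap a Q = 'i *: (b *m b ^t* + v *m v ^t*) ->
  growth a *m (Q - 2 *: (resolvent a *m (v *m v ^t*) *m (resolvent a) ^t*))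
    *m (growth a) ^t* =
  Q + invmx a *m Q *m (invmx a) ^t*
    + invmx a *m (b *m b ^t* - v *m v ^t*) *m (invmx a) ^t*.
Proof.
move=> ua uai; move: (b *m _) (v *m _) => B V lyapQ.
rewrite mulmxBr mulmxBl -scalemxAr -scalemxAl !mulmxA growth_resolvent//.
rewrite -[_ *m (resolvent a) ^t* *m _]mulmxA -adjmxM growth_resolvent//.
rewrite /growth adjmxD adjmxZ conjCi adjmx_scalar conjC1.
have /(congr1 (fun X => invmx a *m X *m (invmx a) ^t*)) := lyapQ.
rewrite /lyap !(mulmxBr, mulmxBl, mulmxDr, mulmxDl, mul1mx, mulmx1).
rewrite -!mulmxA -adjmxM mulVmx// !mulmxA mulVmx// adjmx_scalar conjC1.
rewrite !mulmx1 !mul1mx -!scalemxAl -!scalemxAr -!scalemxAl.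
rewrite mulmxDr mulmxDl.
move: (invmx a *m Q *m _) (invmx a *m B *m _) (invmx a *m V *m _).
move: (invmx a *m Q) (Q *m _) => X Y Z B' V' /matrixP H.
apply/matrixP => i j; rewrite !mxE; move: (H i j); rewrite !mxE => Hij.
have i2 : 'i * 'i = -1 :> C by rewrite -expr2 sqrCi.
(* The hypothesis on Q, conjugated by [invmx a], compares the two cross terms [invmx a *m Q] and
   [Q *m (invmx a) ^t*]. *)
have -> : Y i j = X i j + 'i * (B' i j + V' i j).
  by rewrite -Hij; ring.
ring: i2.
Qed.

End Cayley.

(** * Quadratic forms and lower bounds *)

Section L1Norm.
Variable C : numClosedFieldType.

(** A submultiplicative norm built from finite sums only, hence available over any
    [numClosedFieldType], with values in C. *)
Definition l1norm p q (A : 'M[C]_(p, q)) : C := \sum_i \sum_j `|A i j|.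

Lemma l1norm_ge0 p q (A : 'M[C]_(p, q)) : 0 <= l1norm A.
Proof. by apply: sumr_ge0 => i _; apply: sumr_ge0. Qed.
#[local] Hint Extern 0 (is_true (0 <= l1norm _)) => exact: l1norm_ge0 : core.

Lemma l1norm0 p q : l1norm (0 : 'M[C]_(p, q)) = 0.
Proof. by apply: big1 => i _; apply: big1 => j _; rewrite mxE normr0. Qed.

Lemma entry_le_l1norm p q (A : 'M[C]_(p, q)) i j : `|A i j| <= l1norm A.
Proof.
rewrite /l1norm (bigD1 i)//= (bigD1 j)//= -addrA lerDl.
by rewrite addr_ge0 ?sumr_ge0// => k _; rewrite sumr_ge0.
Qed.

Lemma l1norm_eq0 p q (A : 'M[C]_(p, q)) : l1norm A = 0 -> A = 0.
Proof.
move=> A0; apply/matrixP => i j; rewrite mxE; apply/eqP.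
by rewrite -normr_le0 -A0 entry_le_l1norm.
Qed.

Lemma l1normD p q (A B : 'M[C]_(p, q)) : l1norm (A + B) <= l1norm A + l1norm B.
Proof.
rewrite /l1norm -big_split; apply: ler_sum => i _.
by rewrite -big_split; apply: ler_sum => j _; rewrite mxE ler_normD.
Qed.

Lemma l1normZ p q c (A : 'M[C]_(p, q)) : l1norm (c *: A) = `|c| * l1norm A.
Proof.
rewrite /l1norm mulr_sumr; apply: eq_bigr => i _.
by rewrite mulr_sumr; apply: eq_bigr => j _; rewrite mxE normrM.
Qed.

Lemma l1normN p q (A : 'M[C]_(p, q)) : l1norm (- A) = l1norm A.
Proof. by rewrite -scaleN1r l1normZ normrN1 mul1r. Qed.

Lemma l1norm_adj p q (A : 'M[C]_(p, q)) : l1norm (A ^t*) = l1norm A.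
Proof.
rewrite /l1norm exchange_big; apply: eq_bigr => i _; apply: eq_bigr => j _.
by rewrite !mxE norm_conjC.
Qed.

Lemma l1normM p q r (A : 'M[C]_(p, q)) (B : 'M[C]_(q, r)) :
  l1norm (A *m B) <= l1norm A * l1norm B.
Proof.
rewrite /l1norm mulr_suml; apply: ler_sum => i _.
apply: (@le_trans _ _ (\sum_k \sum_j `|A i j| * `|B j k|)).
  apply: ler_sum => k _; rewrite mxE; apply: (le_trans (ler_norm_sum _ _ _)).
  by apply: ler_sum => j _; rewrite normrM.
rewrite exchange_big mulr_suml; apply: ler_sum => j _.
rewrite -mulr_sumr ler_wpM2l// (bigD1 j)//= lerDl.
by apply: sumr_ge0 => k _; apply: sumr_ge0.
Qed.

Lemma l1norm_row_mx p q r (A : 'M[C]_(p, q)) (B : 'M[C]_(p, r)) :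
  l1norm (row_mx A B) = l1norm A + l1norm B.
Proof.
rewrite /l1norm -big_split; apply: eq_bigr => i _.
rewrite big_split_ord/=.
by congr (_ + _); apply: eq_bigr => j _; rewrite ?row_mxEl ?row_mxEr.
Qed.

Lemma l1norm_le_entry p q (A : 'M[C]_(p, q)) (e : C) :
  (forall i j, `|A i j| <= e) -> l1norm A <= (p * q)%:R * e.
Proof.
move=> Ae; apply: (@le_trans _ _ (\sum_(i < p) \sum_(j < q) e)).
  by apply: ler_sum => i _; apply: ler_sum => j _; apply: Ae.
by rewrite !sumr_const !card_ord -mulrnA mulr_natl mulnC.
Qed.

End L1Norm.
#[local] Hint Extern 0 (is_true (0 <= l1norm _)) => exact: l1norm_ge0 : core.

Section QuadraticForm.
Variables (C : numClosedFieldType) (n : nat).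
Implicit Types (X Y : 'M[C]_n) (x : 'rV[C]_n).

(** Row vectors agree with the left eigenvectors used by [eigenvalue]; [qform 1%:M x] is the squared
    Euclidean length of x. *)
Definition qform X x : C := (x *m X *m x ^t*) 0 0.

Lemma qformD X Y x : qform (X + Y) x = qform X x + qform Y x.
Proof. by rewrite /qform mulmxDr mulmxDl mxE. Qed.

Lemma qformB X Y x : qform (X - Y) x = qform X x - qform Y x.
Proof. by rewrite /qform mulmxBr mulmxBl !mxE. Qed.

Lemma qformZ c X x : qform (c *: X) x = c * qform X x.
Proof. by rewrite /qform -scalemxAr -scalemxAl mxE. Qed.

Lemma qform_sum I (r : seq I) (P : pred I) (F : I -> 'M[C]_n) x :
  qform (\sum_(i <- r | P i) F i) x = \sum_(i <- r | P i) qform (F i) x.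
Proof. by rewrite /qform mulmx_sumr mulmx_suml summxE. Qed.

Lemma qform_conj M X x : qform (M *m X *m M ^t*) x = qform X (x *m M).
Proof. by rewrite /qform adjmxM !mulmxA. Qed.

Lemma qform_gram m (v : 'M[C]_(n, m)) x :
  qform (v *m v ^t*) x = \sum_j `|(x *m v) 0 j| ^+ 2.
Proof.
rewrite /qform mulmxA -mulmxA -adjmxM mxE; apply: eq_bigr => j _.
by rewrite !mxE normCK.
Qed.

Lemma qform_gram_ge0 m (v : 'M[C]_(n, m)) x : 0 <= qform (v *m v ^t*) x.
Proof. by rewrite qform_gram sumr_ge0// => j _; rewrite exprn_ge0. Qed.

Lemma qform_gram_eq0 m (v : 'M[C]_(n, m)) x :
  qform (v *m v ^t*) x = 0 -> x *m v = 0.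
Proof.
rewrite qform_gram => /eqP; rewrite psumr_eq0 => [/allP xv0|j _]; last first.
  by rewrite exprn_ge0.
apply/rowP => j; rewrite [RHS]mxE.
by have := xv0 j (mem_index_enum j); rewrite sqrf_eq0 normr_eq0 => /eqP.
Qed.

Lemma qform1 x : qform 1%:M x = \sum_j `|x 0 j| ^+ 2.
Proof.
have <- : 1%:M *m 1%:M ^t* = 1%:M :> 'M[C]_n.
  by rewrite mul1mx adjmx_scalar conjC1.
by rewrite qform_gram mulmx1.
Qed.

Lemma qform1_ge0 x : 0 <= qform 1%:M x.
Proof. by rewrite qform1 sumr_ge0// => j _; rewrite exprn_ge0. Qed.

Lemma normr_entry_qform1 x j : `|x 0 j| ^+ 2 <= qform 1%:M x.
Proof.
rewrite qform1 (bigD1 j)//= lerDl sumr_ge0// => i _; exact: exprn_ge0.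
Qed.

Lemma qform_le X x :
  `|qform X x| <= l1norm X * qform 1%:M x.
Proof.
rewrite /l1norm /qform -mulmxA mxE mulr_suml.
apply: (le_trans (ler_norm_sum _ _ _)).
apply: ler_sum => i _; rewrite mxE mulr_sumr mulr_suml.
apply: (le_trans (ler_norm_sum _ _ _)); apply: ler_sum => j _.
rewrite [(x ^t*) _ _]mxE [x^T _ _]mxE !normrM norm_conjC mulrCA ler_wpM2l//.
have xi := normr_entry_qform1 x i; have xj := normr_entry_qform1 x j.
(* The products of entries are bounded through 2 s t <= s^2 + t^2. *)
have : 2 * (`|x 0 i| * `|x 0 j|) <= 2 * qform 1%:M x.
  rewrite (_ : 2 * qform _ _ = qform 1%:M x + qform 1%:M x); last by ring.
  apply: le_trans (lerD xi xj); rewrite -subr_ge0.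
  rewrite (_ : _ - _ = (`|x 0 i| - `|x 0 j|) ^+ 2); last by ring.
  by rewrite real_exprn_even_ge0// rpredB// normr_real.
by rewrite ler_pM2l.
Qed.

End QuadraticForm.

(** * Monotonicity of the reduced recursion and decay of the Cayley powers *)

Section Reduced.
Variables (C : numClosedFieldType) (n m1 m2 : nat) (a S0 : 'M[C]_n).
Variables (b : 'M[C]_(n, m1)) (c : 'M[C]_(n, m2)).
Implicit Types x : 'rV[C]_n.

(** Controllability gramian of the discrete-time pair formed by [cayley a] and [resolvent a *m b];
    the factor 2 is the one in [redSS]. *)
Definition gramian : 'M[C]_n :=
  \sum_(k < n) 2 *: ((cayley a ^+ k *m (resolvent a *m b)) *m
                     (cayley a ^+ k *m (resolvent a *m b)) ^t*).

Hypothesis ua : a + 'i%:M \in unitmx.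
Hypothesis lyap0 : lyap a S0 = 'i *: (b *m b ^t* + c *m c ^t*).
Hypothesis S0_ge0 : forall x, 0 <= qform S0 x.

Local Notation redS := (redS a S0 c).

Lemma redS_iter k r : redS (k + r) =
  cayley a ^+ r *m redS k *m (cayley a ^+ r) ^t* +
  \sum_(j < r) 2 *: ((cayley a ^+ j *m (resolvent a *m b)) *m
                     (cayley a ^+ j *m (resolvent a *m b)) ^t*).
Proof.
elim: r => [|r IH].
  by rewrite addn0 big_ord0 addr0 expr0 mul1mx adjmx_scalar conjC1 mulmx1.
rewrite addnS (redSS ua lyap0) IH big_ord_recl expr0 mul1mx exprS.
rewrite mulmxDr mulmxDl -[cayley a * _]/(cayley a *m _).
rewrite [(cayley a *m cayley a ^+ r) ^t*]adjmxM !mulmxA -addrA; congr (_ + _).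
rewrite addrC; congr (_ + _).
  by rewrite [(resolvent a *m b) ^t*]adjmxM !mulmxA.
rewrite mulmx_sumr mulmx_suml.
apply: eq_bigr => j _; rewrite -scalemxAr -scalemxAl.
by rewrite lift0 exprS !adjmxM !mulmxA.
Qed.

Lemma qform_redS_ge0 k x : 0 <= qform (redS k) x.
Proof.
elim: k x => //= k IH x.
have /= -> := redSS ua lyap0 k.
rewrite qformD qformZ !qform_conj addr_ge0 ?mulr_ge0 ?qform_gram_ge0//.
Qed.

Lemma qform_redS_decr k r x : qform (redS (k + r)) x <= qform (redS k) x.
Proof.
elim: r => [|r IH]; rewrite ?addn0// addnS; apply: le_trans IH => /=.
by rewrite qformB lerBlDr lerDl qformZ qform_conj mulr_ge0// qform_gram_ge0.
Qed.

(** The forms decrease in k, so [redS k] dominates [redS (k + n)], which by [redS_iter] is a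
    nonnegative matrix plus the gramian. *)
Lemma qform_redS_ge k x : qform gramian x <= qform (redS k) x.
Proof.
apply: le_trans (qform_redS_decr k n x).
by rewrite redS_iter qformD lerDr qform_conj qform_redS_ge0.
Qed.

Lemma qform_S0_cayley x : qform S0 (x *m cayley a) <= qform S0 x.
Proof.
have := qform_redS_decr 0 1 x; rewrite redS_iter qformD qform_conj expr1 /=.
by apply: le_trans; rewrite lerDl big_ord1 qformZ mulr_ge0// qform_gram_ge0.
Qed.

Lemma qform_S0_cayleyX x :
  qform S0 (x *m cayley a ^+ n) <= qform S0 x - qform gramian x.
Proof.
rewrite lerBrDr -qform_conj -qformD -(redS_iter 0 n).
exact: (qform_redS_decr 0 n).
Qed.

(* [S0 - D^n S0 (D^n)^*] dominates the gramian for [D] the Cayley transform, so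
   [D^n] contracts the norm given by [S0] by the factor [1 - g / s]. *)
Lemma qform_S0_cayley_decay (g s : C) : 0 <= g -> 0 < s ->  g <= s ->
  (forall x, g * qform 1%:M x <= qform gramian x) ->
  (forall x, qform S0 x <= s * qform 1%:M x) ->
  forall K r x, qform S0 (x *m cayley a ^+ (n * K + r)) <=
    (1 - g / s) ^+ K * qform S0 x.
Proof.
move=> g0 s0 gs geg les K; elim=> [|r IH] x; last first.
  apply: le_trans (IH x).
  by rewrite addnS exprSr mulmxA qform_S0_cayley.
rewrite addn0; elim: K x => [|K IH] x.
  by rewrite muln0 !expr0 mulmx1 mul1r.
rewrite mulnS exprD mulmxA; apply: (le_trans (IH _)).
rewrite exprSr -mulrA ler_wpM2l ?exprn_ge0 ?subr_ge0 ?ler_pdivrMr ?mul1r//.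
apply: (le_trans (qform_S0_cayleyX _)); rewrite mulrBl mul1r lerB//.
apply: le_trans (geg x); rewrite -mulrA ler_wpM2l//.
by rewrite mulrC ler_pdivrMr// mulrC.
Qed.

End Reduced.

(** * Quantitative positivity and bounds on inverses *)

Section Positivity.
Variables (C : numClosedFieldType) (n : nat).
Implicit Types (X : 'M[C]_n) (x : 'rV[C]_n).

Lemma qform1_eq0 x : qform 1%:M x = 0 -> x = 0.
Proof.
have <- : 1%:M *m 1%:M ^t* = 1%:M :> 'M[C]_n.
  by rewrite mul1mx adjmx_scalar conjC1.
by move/qform_gram_eq0; rewrite mulmx1.
Qed.

Lemma qform_eigen X x a : x *m X = a *: x -> qform X x = a * qform 1%:M x.
Proof. by move=> xX; rewrite /qform xX mulmx1 -scalemxAl mxE. Qed.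

(** Unitary diagonalization: in the coordinates [x *m P ^t*] the form is a sum of squares weighted
    by the eigenvalues, and the length is unchanged. *)
Lemma eigenvalues_gt0_qform X : X ^t* = X ->
  (forall a, eigenvalue X a -> 0 < a) ->
  exists2 g : C, 0 < g & forall x, g * qform 1%:M x <= qform X x.
Proof.
move=> Xh Xpos; have Xn : X \is normalmx by apply/normalmxP; rewrite Xh.
have := orthomx_spectralP Xn; have := spectral_unitarymx X.
move: (spectralmx X) (spectral_diag X) => P d uP XE.
have PP : P ^t* *m P = 1%:M by rewrite -invmx_unitary// mulVmx// unitarymx_unit.
have PP' : P *m P ^t* = 1%:M by apply/unitarymxP.
rewrite invmx_unitary// in XE.
have d_gt0 j : 0 < d 0 j.
  apply: Xpos; apply/eigenvalueP; exists (row j P).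
    rewrite rowE XE -!mulmxA (mulmxA P) PP' mul1mx mulmxA.
    rewrite -(rowE j (diag_mx d)) row_diag_mx.
    by rewrite -scalemxAl.
  apply/eqP => Pj0; have := congr1 (mulmx^~ (P ^t*)) Pj0.
  rewrite rowE -mulmxA PP' mulmx1 mul0mx => /matrixP /(_ 0 j).
  by rewrite !mxE !eqxx => /eqP; rewrite oner_eq0.
have s_ge0 : 0 <= \sum_j (d 0 j)^-1.
  by apply: sumr_ge0 => j _; rewrite invr_ge0 ltW.
(* A positive number below every [d 0 j]; it replaces a minimum and also makes sense for n = 0. *)
exists (1 + \sum_j (d 0 j)^-1)^-1 => [|x].
  by rewrite invr_gt0 ltr_pwDl.
have -> : qform X x = \sum_j d 0 j * `|(x *m P ^t*) 0 j| ^+ 2.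
  have {1}-> : X = P ^t* *m diag_mx d *m (P ^t*) ^t* by rewrite trmxCK.
  rewrite qform_conj /qform mul_mx_diag mxE; apply: eq_bigr => j _.
  by rewrite !mxE normCK mulrAC mulrC mulrA.
have -> : qform 1%:M x = \sum_j `|(x *m P ^t*) 0 j| ^+ 2.
  by rewrite -PP -{2}[P]trmxCK qform_gram.
rewrite mulr_sumr; apply: ler_sum => j _; rewrite ler_wpM2r ?exprn_ge0//.
rewrite invf_ple ?posrE ?ltr_pwDl// (bigD1 j)//= addrCA lerDl.
by rewrite addr_ge0// sumr_ge0// => i _; rewrite invr_ge0 ltW.
Qed.

(** Evaluating the form at an eigenvector shows that the eigenvalue is positive, so the spectral
    bound applies and no compactness argument is required. *)
Lemma qform_gt0_bound X : X ^t* = X -> (forall x, x != 0 -> 0 < qform X x) ->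
  exists2 g : C, 0 < g & forall x, g * qform 1%:M x <= qform X x.
Proof.
move=> Xh Xpos; apply: eigenvalues_gt0_qform => // a /eigenvalueP[v vX v0].
have := Xpos v v0; rewrite (qform_eigen vX).
rewrite pmulr_lgt0// lt_neqAle qform1_ge0 andbT eq_sym.
by apply: contra v0 => /eqP/qform1_eq0 ->.
Qed.

Section LowerBound.
Variables (g : C) (X : 'M[C]_n).
Hypotheses (g0 : 0 < g) (gX : forall x, g * qform 1%:M x <= qform X x).

Lemma qform_bound_gt0 x : x != 0 -> 0 < qform X x.
Proof.
move=> x0; apply: lt_le_trans (gX x); rewrite pmulr_rgt0//.
rewrite lt_neqAle qform1_ge0 andbT eq_sym.
by apply: contra x0 => /eqP/qform1_eq0 ->.
Qed.

Lemma qform_bound_unit : X \in unitmx.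
Proof.
rewrite -row_free_unit -kermx_eq0; apply/eqP/row_matrixP => i.
rewrite row0; apply/eqP; apply: contraT => /qform_bound_gt0.
by rewrite /qform (sub_kermxP (row_sub i _)) mul0mx mxE ltxx.
Qed.

(** For y the row i of the inverse, y X is a basis vector, so the form at y is the conjugate of its
    entry i. Thus g |y_k|^2 <= |y_i| for all k; taking k = i bounds y_i by 1/g, and then every
    entry. *)
Lemma invmx_entry_le i j : `|invmx X i j| <= g^-1.
Proof.
set y := row i (invmx X).
have yX : y *m X = delta_mx 0 i.
  by rewrite -row_mul mulVmx ?qform_bound_unit// rowE mulmx1.
have qy : qform X y = (y 0 i)^*.
  rewrite /qform yX mxE (bigD1 i)//= big1 ?addr0 => [|k ki].
    by rewrite !mxE !eqxx mul1r.
  by rewrite mxE (negbTE ki) andbF mul0r.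
have le1 k : g * `|y 0 k| ^+ 2 <= `|y 0 i|.
  rewrite -[leRHS]norm_conjC -qy [leRHS]ger0_norm; last first.
    by apply: le_trans (gX y); rewrite mulr_ge0 ?qform1_ge0// ltW.
  by apply: le_trans (gX y); rewrite ler_wpM2l ?normr_entry_qform1// ltW.
have yi : `|y 0 i| <= g^-1.
  have [->|yi0] := eqVneq (y 0 i) 0; first by rewrite normr0 invr_ge0 ltW.
  have := le1 i; rewrite expr2 mulrA -[leRHS]mul1r ler_pM2r ?normr_gt0//.
  by rewrite -ler_pdivlMl// mulr1.
have -> : invmx X i j = y 0 j by rewrite mxE.
rewrite -(@ler_pXn2r _ 2)// ?nnegrE// ?invr_ge0 ?(ltW g0)// exprVn.
by rewrite expr2 invfM ler_pdivlMl// (le_trans (le1 j)).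
Qed.

End LowerBound.
End Positivity.

(** * Consequences of controllability *)

Section Controllable.
Variables (C : numClosedFieldType) (n m1 m2 : nat) (a S0 : 'M[C]_n).
Variables (b : 'M[C]_(n, m1)) (c : 'M[C]_(n, m2)).
Implicit Types x : 'rV[C]_n.

Hypothesis ctrl : row_full (\sum_(k < n) <<(a ^+ k *m b)^T>>)%MS.

(** Dual form of controllability: the images spanning the whole space would lie in the kernel of
    x. *)
Lemma controllable_eq0 x : (forall k, (k < n)%N -> x *m (a ^+ k *m b) = 0) ->
  x = 0.
Proof.
move=> x0; apply: trmx_inj; rewrite trmx0.
have : ((\sum_(k < n) <<(a ^+ k *m b)^T>>)%MS <= kermx x^T)%MS.
  apply/sumsmx_subP => k _; rewrite genmxE; apply/sub_kermxP.
  by rewrite -trmx_mul x0// trmx0.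
move: ctrl; rewrite -sub1mx => /submx_trans h /h /sub_kermxP.
by rewrite mul1mx.
Qed.

Hypothesis lyap0 : lyap a S0 = 'i *: (b *m b ^t* + c *m c ^t*).
Hypothesis S0_gt0 : forall x, x != 0 -> 0 < qform S0 x.

(** The quantity ['i * (l^* - l)] is twice the imaginary part of l. Evaluating the Lyapunov identity
    at a left eigenvector x makes it positive unless x b = 0; but then x kills every a^k b, against
    controllability. *)
Lemma eigenvalue_upper (l : C) : eigenvalue a l -> 0 < 'i * (l^* - l).
Proof.
move=> /eigenvalueP[x xa x0].
have E : qform (lyap a S0) x = (l - l^*) * qform S0 x.
  rewrite /lyap qformB /qform !mulmxA xa -[_ *m a ^t* *m _]mulmxA -adjmxM xa.
  by rewrite adjmxZ -!scalemxAl -scalemxAr mulrBl; congr (_ - _); rewrite mxE.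
have b0 : 0 < qform (b *m b ^t*) x.
  rewrite lt_neqAle qform_gram_ge0 andbT eq_sym; apply: contra x0 => /eqP.
  move=> /qform_gram_eq0 xb; apply/eqP/controllable_eq0 => k _.
  suff -> : x *m (a ^+ k *m b) = l ^+ k *: (x *m b) by rewrite xb scaler0.
  elim: k => [|k IH]; first by rewrite !expr0 mul1mx scale1r.
  rewrite exprS -[a * _]/(a *m _) !mulmxA xa -!scalemxAl -mulmxA IH scalerA.
  by rewrite exprS.
have : 0 < 'i * (l^* - l) * qform S0 x.
  have -> : 'i * (l^* - l) * qform S0 x = - 'i * qform (lyap a S0) x.
    by rewrite E; ring.
  rewrite lyap0 qformZ qformD mulrA mulNr -expr2 sqrCi opprK mul1r.
  by rewrite ltr_wpDr// qform_gram_ge0.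
by rewrite pmulr_lgt0// S0_gt0.
Qed.

Lemma admissible_unit : a \in unitmx.
Proof.
rewrite -row_free_unit -kermx_eq0; apply: contraT => a0.
have /eigenvalue_upper : eigenvalue a 0.
  by rewrite /eigenvalue /eigenspace raddf0 subr0.
by rewrite conjC0 subrr mulr0 ltxx.
Qed.

Lemma admissible_unit_addi : a + 'i%:M \in unitmx.
Proof.
rewrite -row_free_unit -kermx_eq0; apply: contraT => a0.
have /eigenvalue_upper : eigenvalue a (- 'i).
  by rewrite /eigenvalue /eigenspace raddfN opprK.
rewrite rmorphN/= conjCi opprK mulrDr -expr2 sqrCi -opprD oppr_gt0.
by rewrite lt_gtF// addr_gt0.
Qed.

(** A null vector x kills D^k R b for k < n. As D = 1 - 2 i R, powers of D are traded for powers of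
    R; as R a = 1 - i R, powers of R are then traded for powers of a. In the end x R^n kills a^k b
    for all k < n, so x R^n = 0, and R is invertible. *)
Lemma gramian_gt0 x : x != 0 -> 0 < qform (gramian a b) x.
Proof.
move=> xn0; pose R := resolvent a; pose D := cayley a.
have gram_ge0 (k : 'I_n) : 0 <=
    qform (2 *: ((D ^+ k *m (R *m b)) *m (D ^+ k *m (R *m b)) ^t*)) x.
  by rewrite qformZ mulr_ge0// qform_gram_ge0.
rewrite /gramian qform_sum lt_neqAle sumr_ge0// andbT eq_sym.
apply: contra xn0; rewrite psumr_eq0// => /allP x0; apply/eqP.
have ua := admissible_unit_addi.
have RE : R *m (a + 'i%:M) = 1%:M by rewrite mulVmx.
have DE : D = 1%:M - (2 * 'i) *: R.
  rewrite /D /cayley -/R -RE -mul_mx_scalar -mulmxBr; congr (_ *m _).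
  by apply/matrixP => i j; rewrite !mxE; case: eqP => _; ring.
have RD : R *m D = D *m R by apply: cayley_resolvent.
(* Induction on l: expanding the last factor D in D^k R^(l+1) D b isolates D^k R^(l+2) b. Each step
   costs one power of D, whence the constraint k + l < n. *)
have xDRb l k : (k + l < n)%N -> x *m (D ^+ k *m (R ^+ l.+1 *m b)) = 0.
  elim: l k => [|l IH] k kl.
    rewrite addn0 in kl; rewrite expr1; apply: qform_gram_eq0; apply/eqP.
    have := x0 (Ordinal kl) (mem_index_enum _).
    by rewrite qformZ mulf_eq0 pnatr_eq0.
  have := congr1 (fun M => x *m (D ^+ k *m (R ^+ l.+1 *m (M *m b)))) DE.
  have /= RlD : D *m R ^+ l.+1 = R ^+ l.+1 *m D by apply/commrX/esym.
  rewrite [R ^+ _ *m (D *m b)]mulmxA -RlD -[D *m _ *m b]mulmxA.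
  rewrite [D ^+ k *m (D *m _)]mulmxA -[_ *m D]/(_ * D) -exprSr.
  rewrite IH ?addSnnS// mulmxBl mul1mx !mulmxBr IH; last first.
    by apply: leq_trans kl; rewrite addnS.
  rewrite sub0r -[_ *: R *m b]scalemxAl.
  rewrite -!scalemxAr [R ^+ l.+1 *m _]mulmxA -[_ *m R]/(_ * R) -exprSr.
  move/eqP; rewrite eq_sym oppr_eq0 scaler_eq0 mulf_eq0 pnatr_eq0/=.
  by rewrite (negbTE (neq0Ci C)) => /eqP.
have Ra : R *m a = 1%:M - 'i *: R.
  by rewrite -RE mulmxDr mul_mx_scalar addrK.
have xRa p l : (l < n)%N -> (p <= l)%N ->
    x *m (R ^+ l.+1 *m (a ^+ p *m b)) = 0.
  elim: p l => [|p IH] l ln pl.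
    by have := xDRb l 0; rewrite !expr0 !mul1mx; apply.
  case: l ln pl => // l ln pl.
  rewrite [a ^+ p.+1]exprS [R ^+ l.+2]exprSr.
  rewrite -[a * _]/(a *m _) -[_ * R]/(_ *m R).
  rewrite -mulmxA -[a *m _ *m b]mulmxA [R *m (a *m _)]mulmxA Ra mulmxBl mul1mx.
  rewrite -scalemxAl !mulmxBr IH ?(ltnW ln)// sub0r -!scalemxAr.
  rewrite [R ^+ l.+1 *m _]mulmxA -[_ *m R]/(_ * R) -exprSr IH ?(ltnW pl)//.
  by rewrite scaler0 oppr0.
(* The exponent l = n - 1 used below requires n to be positive. *)
have [n0|n_gt0] := posnP n.
  by move: (x); rewrite n0 => y; rewrite [y]thinmx0.
have uR k : R ^+ k \in unitmx.
  elim: k => [|k IH]; first by rewrite expr0 unitmx1.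
  by rewrite exprS unitmx_mul unitmx_inv ua.
have: x *m R ^+ n = 0.
  apply: controllable_eq0 => k kn.
  have := xRa k n.-1; rewrite prednK// leqnn -ltnS prednK// => h.
  by rewrite -mulmxA h.
by move/(congr1 (mulmx^~ (invmx (R ^+ n)))); rewrite mul0mx mulmxK.
Qed.

End Controllable.

(** * Convergence of matrices along a filter *)

Section Null.
Variables (C : numClosedFieldType) (T : Type) (F : set_system T).
Context {FF : Filter F}.

(** Since [0 < e] in C forces e to be real, this is ordinary convergence to 0 in norm along F. *)
Definition mxnull p q (A : T -> 'M[C]_(p, q)) :=
  forall e : C, 0 < e -> \forall t \near F, l1norm (A t) < e.

Definition mxbounded p q (A : T -> 'M[C]_(p, q)) :=
  exists2 M : C, 0 <= M & \forall t \near F, l1norm (A t) <= M.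

Definition mxcvg p q (A : T -> 'M[C]_(p, q)) A0 := mxnull (fun t => A t - A0).

Lemma mxnull_eq p q (A B : T -> 'M[C]_(p, q)) :
  (\forall t \near F, A t = B t) -> mxnull A -> mxnull B.
Proof. by move=> AB A0 e /A0; apply: filterS2 AB => t ->. Qed.

Lemma mxnull0 p q : mxnull (fun=> 0 : 'M[C]_(p, q)).
Proof. by move=> e e0; apply: nearW => t; rewrite l1norm0. Qed.

Lemma mxnullD p q (A B : T -> 'M[C]_(p, q)) :
  mxnull A -> mxnull B -> mxnull (fun t => A t + B t).
Proof.
move=> A0 B0 e e0; have e2 : 0 < e / 2 by rewrite divr_gt0.
move: (A0 _ e2) (B0 _ e2); apply: filterS2 => t At Bt.
by rewrite [e]splitr (le_lt_trans (l1normD _ _))// ltrD.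
Qed.

Lemma mxnullN p q (A : T -> 'M[C]_(p, q)) :
  mxnull A -> mxnull (fun t => - A t).
Proof. by move=> A0 e /A0; apply: filterS => t; rewrite l1normN. Qed.

Lemma mxnull_adj p q (A : T -> 'M[C]_(p, q)) :
  mxnull A -> mxnull (fun t => (A t) ^t*).
Proof. by move=> A0 e /A0; apply: filterS => t; rewrite l1norm_adj. Qed.

Lemma mxbounded_adj p q (A : T -> 'M[C]_(p, q)) :
  mxbounded A -> mxbounded (fun t => (A t) ^t*).
Proof.
by move=> [M M0 AM]; exists M => //; apply: filterS AM => t; rewrite l1norm_adj.
Qed.

Lemma mxnullMl p q r (A : T -> 'M[C]_(p, q)) (B : T -> 'M[C]_(q, r)) :
  mxnull A -> mxbounded B -> mxnull (fun t => A t *m B t).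
Proof.
(* The bound M may be 0, so the division is by M + 1. *)
move=> A0 [M M0 BM] e e0; have M1 : 0 < M + 1 by rewrite ltr_wpDl.
have e1 : 0 < e / (M + 1) by rewrite divr_gt0.
move: (A0 _ e1) BM; apply: filterS2 => t At Bt.
rewrite (le_lt_trans (l1normM _ _))//; move: At; rewrite ltr_pdivlMr//.
by apply: le_lt_trans; rewrite ler_wpM2l// (le_trans Bt)// lerDl.
Qed.

Lemma mxnullMr p q r (A : T -> 'M[C]_(p, q)) (B : T -> 'M[C]_(q, r)) :
  mxbounded A -> mxnull B -> mxnull (fun t => A t *m B t).
Proof.
move=> [M M0 AM] B0 e e0; have M1 : 0 < M + 1 by rewrite ltr_wpDl.
have e1 : 0 < e / (M + 1) by rewrite divr_gt0.
move: (B0 _ e1) AM; apply: filterS2 => t Bt At.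
rewrite (le_lt_trans (l1normM _ _))//; move: Bt; rewrite ltr_pdivlMr// mulrC.
by apply: le_lt_trans; rewrite ler_wpM2r// (le_trans At)// lerDl.
Qed.

Lemma mxboundedM p q r (A : T -> 'M[C]_(p, q)) (B : T -> 'M[C]_(q, r)) :
  mxbounded A -> mxbounded B -> mxbounded (fun t => A t *m B t).
Proof.
move=> [M M0 AM] [N N0 BN]; exists (M * N); first exact: mulr_ge0.
move: AM BN; apply: filterS2 => t At Bt.
by rewrite (le_trans (l1normM _ _))// ler_pM.
Qed.

Lemma mxbounded_cst p q (A : 'M[C]_(p, q)) : mxbounded (fun=> A).
Proof. by exists (l1norm A) => //; apply: nearW. Qed.

Lemma mxbounded_cvg p q (A : T -> 'M[C]_(p, q)) A0 :
  mxcvg A A0 -> mxbounded A.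
Proof.
move=> AA0; exists (1 + l1norm A0); first by rewrite addr_ge0.
have := AA0 1 ltr01; apply: filterS => t At.
by rewrite -[A t](subrK A0) (le_trans (l1normD _ _))// lerD2r ltW.
Qed.

Lemma mxbounded_null p q (A : T -> 'M[C]_(p, q)) : mxnull A -> mxbounded A.
Proof.
move=> A0; apply: (@mxbounded_cvg _ _ _ 0); apply: mxnull_eq A0.
by apply: nearW => t; rewrite subr0.
Qed.

Lemma mxnullZ p q c (A : T -> 'M[C]_(p, q)) :
  mxnull A -> mxnull (fun t => c *: A t).
Proof.
move=> A0; apply: mxnull_eq (mxnullMr (mxbounded_cst c%:M) A0).
by apply: nearW => t; rewrite mul_scalar_mx.
Qed.

Lemma mxnull_row_mx p q r (A : T -> 'M[C]_(p, q)) (B : T -> 'M[C]_(p, r)) :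
  mxnull A -> mxnull B -> mxnull (fun t => row_mx (A t) (B t)).
Proof.
move=> cA cB e e0; have e2 : 0 < e / 2 by rewrite divr_gt0.
move: (cA _ e2) (cB _ e2); apply: filterS2 => t At Bt.
by rewrite l1norm_row_mx [e]splitr ltrD.
Qed.

Lemma mxbounded_row_mx p q r (A : T -> 'M[C]_(p, q)) (B : T -> 'M[C]_(p, r)) :
  mxbounded A -> mxbounded B -> mxbounded (fun t => row_mx (A t) (B t)).
Proof.
move=> [M M0 AM] [N N0 BN]; exists (M + N); first exact: addr_ge0.
by move: AM BN; apply: filterS2 => t At Bt; rewrite l1norm_row_mx lerD.
Qed.

Lemma mxcvg_cst p q (A : 'M[C]_(p, q)) : mxcvg (fun=> A) A.
Proof. by move=> e e0; apply: nearW => t; rewrite subrr l1norm0. Qed.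

Lemma mxcvgD p q (A B : T -> 'M[C]_(p, q)) A0 B0 :
  mxcvg A A0 -> mxcvg B B0 -> mxcvg (fun t => A t + B t) (A0 + B0).
Proof.
move=> cA cB; apply: mxnull_eq (mxnullD cA cB); apply: nearW => t.
by rewrite opprD addrACA.
Qed.

(** Uses A B - A0 B0 = (A - A0) B + A0 (B - B0). *)
Lemma mxcvgM p q r (A : T -> 'M[C]_(p, q)) (B : T -> 'M[C]_(q, r)) A0 B0 :
  mxcvg A A0 -> mxcvg B B0 -> mxcvg (fun t => A t *m B t) (A0 *m B0).
Proof.
move=> cA cB.
apply: mxnull_eq (mxnullD (mxnullMl cA (mxbounded_cvg cB))
  (mxnullMr (mxbounded_cst A0) cB)); apply: nearW => t.
by rewrite mulmxBl mulmxBr addrA subrK.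
Qed.

Lemma mxcvgZ p q c (A : T -> 'M[C]_(p, q)) A0 :
  mxcvg A A0 -> mxcvg (fun t => c *: A t) (c *: A0).
Proof.
move=> cA; apply: mxnull_eq (mxcvgM (mxcvg_cst c%:M) cA).
by apply: nearW => t; rewrite !mul_scalar_mx.
Qed.

Lemma mxcvgB p q (A B : T -> 'M[C]_(p, q)) A0 B0 :
  mxcvg A A0 -> mxcvg B B0 -> mxcvg (fun t => A t - B t) (A0 - B0).
Proof.
move=> cA /(mxcvgZ (-1)) cB; apply: mxnull_eq (mxcvgD cA cB).
by apply: nearW => t; rewrite !scaleN1r.
Qed.

Lemma mxcvg_adj p q (A : T -> 'M[C]_(p, q)) A0 :
  mxcvg A A0 -> mxcvg (fun t => (A t) ^t*) (A0 ^t*).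
Proof.
by move=> /mxnull_adj; apply: mxnull_eq; apply: nearW => t; rewrite adjmxB.
Qed.

Lemma mxcvgX n (A : T -> 'M[C]_n) A0 k :
  mxcvg A A0 -> mxcvg (fun t => A t ^+ k) (A0 ^+ k).
Proof.
move=> cA; elim: k => [|k IH]; first exact: mxcvg_cst.
by apply: mxnull_eq (mxcvgM cA IH); apply: nearW => t; rewrite !exprS.
Qed.

Lemma mxcvg_sum p q I (r : seq I) (A : I -> T -> 'M[C]_(p, q)) A0 :
  (forall i, mxcvg (A i) (A0 i)) ->
  mxcvg (fun t => \sum_(i <- r) A i t) (\sum_(i <- r) A0 i).
Proof.
move=> cA; elim: r => [|i r IH].
  by apply: mxnull_eq (mxcvg_cst 0); apply: nearW => t; rewrite !big_nil.
by apply: mxnull_eq (mxcvgD (cA i) IH); apply: nearW => t; rewrite !big_cons.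
Qed.

Lemma mxcvg_row_mx p q r (A : T -> 'M[C]_(p, q)) (B : T -> 'M[C]_(p, r)) A0 B0 :
  mxcvg A A0 -> mxcvg B B0 ->
  mxcvg (fun t => row_mx (A t) (B t)) (row_mx A0 B0).
Proof.
move=> cA cB; apply: mxnull_eq (mxnull_row_mx cA cB); apply: nearW => t.
by rewrite opp_row_mx add_row_mx.
Qed.

(** * Continuity of matrix inversion *)

Section Inverse.
Variables (n : nat) (A : T -> 'M[C]_n) (A0 : 'M[C]_n).
Hypotheses (cA : mxcvg A A0) (uA0 : A0 \in unitmx).

Lemma near_half : \forall t \near F, l1norm ((A0 - A t) *m invmx A0) < 2^-1.
Proof.
apply: (mxnullMl _ (mxbounded_cst (invmx A0))); last by rewrite invr_gt0.
by apply: mxnull_eq (mxnullN cA); apply: nearW => t; rewrite opprB.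
Qed.

(** If K A = 0 then K = K (A0 - A) A0^-1, so the norm of K is at most half of itself. *)
Lemma near_unitmx : \forall t \near F, A t \in unitmx.
Proof.
move: near_half; apply: filterS => t At.
rewrite -row_free_unit -kermx_eq0; apply/eqP/l1norm_eq0/le_anti.
rewrite l1norm_ge0 andbT; set K := kermx _.
have KE : K = K *m ((A0 - A t) *m invmx A0).
  by rewrite mulmxA mulmxBr mulmx_ker subr0 mulmxK.
have : l1norm K <= l1norm K * 2^-1.
  rewrite {1}KE (le_trans (l1normM _ _))// ler_wpM2l// ltW//.
rewrite -subr_ge0 (_ : _ - _ = - (l1norm K / 2)) ?oppr_ge0; last by field.
by rewrite pmulr_lle0// invr_gt0.
Qed.

(** The inverse X satisfies X = A0^-1 + X (A0 - A) A0^-1, whose last term has at most half the norm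
    of X and is absorbed on the left. *)
Lemma mxbounded_inv : mxbounded (fun t => invmx (A t)).
Proof.
exists (2 * l1norm (invmx A0)); first by rewrite mulr_ge0.
move: near_half near_unitmx; apply: filterS2 => t At uAt; set X := invmx (A t).
have XE : X = invmx A0 + X *m ((A0 - A t) *m invmx A0).
  by rewrite mulmxBl mulmxV// mulmxBr mulmx1 mulmxA mulVmx// mul1mx addrC subrK.
have : l1norm X <= l1norm (invmx A0) + l1norm X * 2^-1.
  rewrite {1}XE (le_trans (l1normD _ _))// lerD2l (le_trans (l1normM _ _))//.
  by rewrite ler_wpM2l// ltW.
rewrite -lerBlDr (_ : _ - _ = l1norm X / 2); last by field.
by rewrite ler_pdivrMr// mulrC.
Qed.

Lemma mxcvg_inv : mxcvg (fun t => invmx (A t)) (invmx A0).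
Proof.
apply: mxnull_eq (mxnullMl (mxnullMr mxbounded_inv (mxnullN cA))
  (mxbounded_cst (invmx A0))).
move: near_unitmx; apply: filterS => t uAt.
by rewrite opprB mulmxBr mulVmx// mulmxBl mul1mx -mulmxA mulmxV// mulmx1.
Qed.

End Inverse.
End Null.

(** * Uniform convergence of the reduced potential *)

Lemma near_below (T : Type) (F : set_system T) (P : T -> nat -> Prop) N :
  Filter F ->
  (forall k, \forall t \near F, P t k) ->
  \forall t \near F, forall k, (k < N)%N -> P t k.
Proof.
move=> FF FP; elim: N => [|N IH]; first exact: nearW.
move: IH (FP N); apply: filterS2 => t IH PN k.
by rewrite ltnS leq_eqVlt => /predU1P[->//|/IH].
Qed.

Section Uniform.
Variable C : numClosedFieldType.
(** An abstract [numClosedFieldType] can be non-archimedean, so the decay of geometric sequences is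
    assumed here and established for [R[i]] in [complex_exprn_small]. *)
Hypothesis archi : forall r e : C, 0 <= r -> r < 1 -> 0 < e ->
  exists K, r ^+ K < e.
Variables (n m1 m2 : nat).

(* [A^-k Lambda_k] for [A = growth a], see [Lambda_red]. *)
Definition redL (a : 'M[C]_n) (b : 'M[C]_(n, m1)) (c : 'M[C]_(n, m2)) k :=
  row_mx b (cayley a ^+ k *m c).

Definition redF (a S0 : 'M[C]_n) b c k :=
  (redL a b c k) ^t* *m invmx (redS a S0 c k) *m redL a b c k.

(* [admissible] over an arbitrary numClosedFieldType. *)
Definition admissible_form (a S0 : 'M[C]_n) (b : 'M[C]_(n, m1))
    (c : 'M[C]_(n, m2)) :=
  [/\ S0 ^t* = S0, forall x, x != 0 -> 0 < qform S0 x &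
      lyap a S0 = 'i *: (b *m b ^t* + c *m c ^t*)].

Lemma admissible_form_ge0 a S0 b c : admissible_form a S0 b c ->
  forall x, 0 <= qform S0 x.
Proof.
move=> [_ S0_gt0 _] x; have [->|/S0_gt0/ltW//] := eqVneq x 0.
by rewrite /qform !mul0mx mxE.
Qed.

Variables (T : Type) (F : set_system T).
Context {FF : Filter F}.
Variables (a S : T -> 'M[C]_n).
Variables (b : T -> 'M[C]_(n, m1)) (c : T -> 'M[C]_(n, m2)).
Variables (a0 S0 : 'M[C]_n) (b0 : 'M[C]_(n, m1)) (c0 : 'M[C]_(n, m2)).
Hypotheses (cvg_a : mxcvg F a a0) (cvg_S : mxcvg F S S0).
Hypotheses (cvg_b : mxcvg F b b0) (cvg_c : mxcvg F c c0).
Hypothesis adm : \forall t \near F, admissible_form (a t) (S t) (b t) (c t).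
Hypothesis adm0 : admissible_form a0 S0 b0 c0.
Hypothesis ctrl0 : row_full (\sum_(k < n) <<(a0 ^+ k *m b0)^T>>)%MS.

Let cvg_addi : mxcvg F (fun t => a t + 'i%:M) (a0 + 'i%:M).
Proof. exact: mxcvgD cvg_a (mxcvg_cst _). Qed.

Let unit0i : a0 + 'i%:M \in unitmx.
Proof.
by case: adm0 => _ S0_gt0 lyap0; apply: admissible_unit_addi lyap0 S0_gt0.
Qed.

Lemma mxcvg_resolvent : mxcvg F (fun t => resolvent (a t)) (resolvent a0).
Proof. exact: mxcvg_inv. Qed.

Lemma mxcvg_cayley : mxcvg F (fun t => cayley (a t)) (cayley a0).
Proof.
exact: mxcvgM mxcvg_resolvent (mxcvgB cvg_a (mxcvg_cst _)).
Qed.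

Lemma mxcvg_cayleyXc k :
  mxcvg F (fun t => cayley (a t) ^+ k *m c t) (cayley a0 ^+ k *m c0).
Proof. exact: mxcvgM (mxcvgX _ mxcvg_cayley) cvg_c. Qed.

Lemma mxcvg_gramian : mxcvg F (fun t => gramian (a t) (b t)) (gramian a0 b0).
Proof.
apply: mxcvg_sum => k; apply: mxcvgZ.
have H : mxcvg F (fun t => cayley (a t) ^+ k *m (resolvent (a t) *m b t))
           (cayley a0 ^+ k *m (resolvent a0 *m b0)).
  exact: mxcvgM (mxcvgX _ mxcvg_cayley) (mxcvgM mxcvg_resolvent cvg_b).
exact: mxcvgM H (mxcvg_adj H).
Qed.

Lemma mxcvg_redS k :
  mxcvg F (fun t => redS (a t) (S t) (c t) k) (redS a0 S0 c0 k).
Proof.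
elim: k => [//|k IH]; apply: mxcvgB IH _; apply: mxcvgZ.
have H := mxcvg_cayleyXc k.
exact: mxcvgM (mxcvgM mxcvg_resolvent (mxcvgM H (mxcvg_adj H)))
  (mxcvg_adj mxcvg_resolvent).
Qed.

Lemma gramian_adj (a' : 'M[C]_n) (b' : 'M[C]_(n, m1)) :
  (gramian a' b') ^t* = gramian a' b'.
Proof.
rewrite /gramian raddf_sum map_mx_sum; apply: eq_bigr => k _.
rewrite adjmxZ conjC_nat; move: (cayley a' ^+ k *m _) => v.
by rewrite adjmxM trmxCK.
Qed.

Lemma qform_gramian_ge0 (a' : 'M[C]_n) (b' : 'M[C]_(n, m1)) x :
  0 <= qform (gramian a' b') x.
Proof.
rewrite /gramian qform_sum sumr_ge0// => k _.
by rewrite qformZ mulr_ge0// qform_gram_ge0.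
Qed.

(** The point is that g and s do not depend on t: they give one contraction rate and one bound on
    the inverses for all nearby quadruples. *)
Definition uniformly_bounded (g s : C) t :=
  [/\ a t + 'i%:M \in unitmx, admissible_form (a t) (S t) (b t) (c t),
      forall x, g * qform 1%:M x <= qform (gramian (a t) (b t)) x &
      forall x, qform (S t) x <= s * qform 1%:M x].

Lemma gramian0_bound : exists2 g : C, 0 < g &
  forall x, g * qform 1%:M x <= qform (gramian a0 b0) x.
Proof.
apply: qform_gt0_bound (gramian_adj _ _) _ => x.
by case: adm0 => _ S0_gt0 lyap0; apply: (gramian_gt0 ctrl0 lyap0 S0_gt0).
Qed.

Lemma near_uniformly_bounded : exists g s, [/\ 0 < g, 0 < s, g <= s &
  \forall t \near F, uniformly_bounded g s t].
Proof.
have [g g_gt0 gG] := gramian0_bound.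
have [M M_ge0 SM] : mxbounded F S by exact: mxbounded_cvg cvg_S.
have g2_gt0 : 0 < g / 2 by rewrite divr_gt0.
(* Half of the lower bound is given up to the perturbation of the gramian. Adding g / 2 to M makes s
   positive and at least g / 2. *)
exists (g / 2), (M + g / 2); split => //; rewrite ?ltr_wpDl ?lerDr//.
have cG := mxcvg_gramian g2_gt0.
have uN := @near_unitmx _ _ _ FF _ _ _ cvg_addi unit0i.
have near1 := @filterI _ F FF _ _ uN adm.
have near2 := @filterI _ F FF _ _ cG SM.
move: near1 near2; apply: filterS2 => t [ut At] [GtM StM]; split => [//|//|x|x].
- have : qform (gramian a0 b0) x - qform (gramian (a t) (b t)) x
      <= g / 2 * qform 1%:M x.
    rewrite (le_trans (real_ler_norm _))//.
      by rewrite rpredB// ger0_real// qform_gramian_ge0.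
    rewrite distrC -qformB (le_trans (qform_le _ _))// ler_wpM2r ?qform1_ge0//.
    exact: ltW.
  rewrite lerBlDr -lerBlDl; apply: le_trans; rewrite lerBrDr.
  by rewrite -mulrDl -splitr.
- rewrite -[leLHS]ger0_norm ?(admissible_form_ge0 At)//.
  rewrite (le_trans (qform_le _ _))// ler_wpM2r ?qform1_ge0//.
  by rewrite (le_trans StM)// lerDl ltW.
Qed.

(** Convergence along this product filter means: for k large, uniformly over t in some member of
    F. *)
Local Notation G := (filter_prod F \oo).

Lemma near_prod (P : T -> nat -> Prop) N :
  (\forall t \near F, forall k, (N <= k)%N -> P t k) ->
  \forall p \near G, P p.1 p.2.
Proof.
move=> FP.
exists ([set t | forall k, (N <= k)%N -> P t k], [set k | (N <= k)%N]).
  by split => //; exists N.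
by move=> [t k] [/= Pt Nk]; apply: Pt.
Qed.

Lemma qform1_delta (i : 'I_n) : qform (1%:M : 'M[C]_n) (delta_mx 0 i) = 1.
Proof.
rewrite qform1 (bigD1 i)//= big1 ?addr0 => [|j ji].
  by rewrite mxE !eqxx normr1 expr1n.
by rewrite mxE (negbTE ji) andbF normr0 expr0n.
Qed.

(** Each row of a power of D is the image of a basis vector. Its length is controlled by the form of
    S, which shrinks by the factor 1 - g / s every n steps. *)
Lemma mxnull_cayleyX : mxnull G (fun p => cayley (a p.1) ^+ p.2).
Proof.
have [g [s [g_gt0 s_gt0 gs nearB]]] := near_uniformly_bounded.
move=> e e_gt0; have e1_gt0 : 0 < e / ((n * n)%:R + 1).
  by rewrite divr_gt0// ltr_wpDl.
have gs_gt0 : 0 < g / s by rewrite divr_gt0.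
(* After multiplication by s / g this power bounds the squared length of a row, which has to lie
   below the square of the tolerance per entry. *)
have [K rK] : exists K, (1 - g / s) ^+ K <
    (e / ((n * n)%:R + 1)) ^+ 2 * (g / s).
  apply: archi; last by rewrite mulr_gt0// exprn_gt0.
    by rewrite subr_ge0 ler_pdivrMr// mul1r.
  by rewrite ltrBlDr ltrDl.
apply: (@near_prod (fun t k => l1norm (cayley (a t) ^+ k) < e) (n * K)).
move: nearB; apply: filterS => t [ut At gG Ss] k /subnKC <-.
move: (k - n * K)%N => {k} r.
have St_ge0 := admissible_form_ge0 At; have [_ _ lyapt] := At.
apply: (@le_lt_trans _ _ ((n * n)%:R * (e / ((n * n)%:R + 1)))); last first.
  rewrite mulrA ltr_pdivrMr ?ltr_wpDl// mulrC ltr_pM2l// ltrDl//.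
apply: l1norm_le_entry => i j; apply: ltW.
rewrite -(@ltr_pXn2r _ 2) ?nnegrE// ?(ltW e1_gt0)//.
have -> : (cayley (a t) ^+ (n * K + r)) i j =
    ((delta_mx 0 i : 'rV_n) *m cayley (a t) ^+ (n * K + r)) 0 j
  by rewrite -rowE mxE.
apply: (le_lt_trans (normr_entry_qform1 _ _)); set y := _ *m _.
have : g * qform 1%:M y <= (1 - g / s) ^+ K * s.
  apply: (le_trans (gG y)).
  (* Index 0 is used because [redS] there is S itself: the gramian is dominated by S. *)
  apply: (le_trans (qform_redS_ge ut lyapt St_ge0 0 y)) => /=.
  apply: (le_trans (qform_S0_cayley_decay ut lyapt (ltW g_gt0) s_gt0 gs gG Ss
    _ _ _)).
  rewrite ler_wpM2l ?exprn_ge0 ?subr_ge0 ?ler_pdivrMr ?mul1r//.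
  by rewrite (le_trans (Ss _))// qform1_delta mulr1.
rewrite mulrC -ler_pdivlMr//; move/le_lt_trans; apply.
by rewrite -mulrA -ltr_pdivlMr ?divr_gt0// invf_div.
Qed.

Lemma mxbounded_fst p q (A : T -> 'M[C]_(p, q)) :
  mxbounded F A -> mxbounded G (A \o fst).
Proof. by move=> [M M0 AM]; exists M => //; apply: cvg_fst AM. Qed.

Lemma mxnull_snd_succ p q (A : T -> nat -> 'M[C]_(p, q)) :
  mxnull G (fun p => A p.1 p.2) -> mxnull G (fun p => A p.1 p.2.+1).
Proof.
move=> A0 e /A0[[P Q] /= [FP [N _ NQ]] PQ].
exists (P, [set k | (N <= k)%N]); first by split => //; exists N.
move=> [t k] [/= Pt Nk]; apply: (PQ (t, k.+1)); split => //.
by apply: NQ; rewrite /= ltnW.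
Qed.

Lemma mxbounded_snd_succ p q (A : T -> nat -> 'M[C]_(p, q)) :
  mxbounded G (fun p => A p.1 p.2) -> mxbounded G (fun p => A p.1 p.2.+1).
Proof.
move=> [M M0 [[P Q] /= [FP [N _ NQ]] PQ]]; exists M => //.
exists (P, [set k | (N <= k)%N]); first by split => //; exists N.
move=> [t k] [/= Pt Nk]; apply: (PQ (t, k.+1)); split => //.
by apply: NQ; rewrite /= ltnW.
Qed.

(** The lower bound g passes from the gramian to every [redS k], so the inverses are bounded
    uniformly in k. *)
Lemma redS_inv_bound g (a' S' : 'M[C]_n) b' c' k : 0 < g ->
  a' + 'i%:M \in unitmx -> admissible_form a' S' b' c' ->
  (forall x, g * qform 1%:M x <= qform (gramian a' b') x) ->
  redS a' S' c' k \in unitmx /\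
  forall i j, `|invmx (redS a' S' c' k) i j| <= g^-1.
Proof.
move=> g_gt0 ua' adm' gG; have S_ge0 := admissible_form_ge0 adm'.
have [_ _ lyap'] := adm'.
have gQ x : g * qform 1%:M x <= qform (redS a' S' c' k) x.
  by apply: le_trans (gG x) _; apply: qform_redS_ge.
by split; [exact: qform_bound_unit gQ|exact: invmx_entry_le].
Qed.

Lemma mxnull_cayleyXc : mxnull G (fun p => cayley (a p.1) ^+ p.2 *m c p.1).
Proof.
have := mxnullMl mxnull_cayleyX (mxbounded_fst (mxbounded_cvg cvg_c)).
exact.
Qed.

Lemma mxbounded_inv_redS :
  mxbounded G (fun p => invmx (redS (a p.1) (S p.1) (c p.1) p.2)).
Proof.
have [g [s [g_gt0 s_gt0 gs nearB]]] := near_uniformly_bounded.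
exists ((n * n)%:R * g^-1); first by rewrite mulr_ge0// invr_ge0 ltW.
apply: (@near_prod
  (fun t k => l1norm (invmx (redS (a t) (S t) (c t) k)) <= _) 0).
move: nearB; apply: filterS => t [ut At gG _] k _; apply: l1norm_le_entry.
by have [] := redS_inv_bound k g_gt0 ut At gG.
Qed.

Lemma near_redS_unit :
  \forall p \near G, redS (a p.1) (S p.1) (c p.1) p.2 \in unitmx.
Proof.
have [g [s [g_gt0 s_gt0 gs nearB]]] := near_uniformly_bounded.
apply: (@near_prod (fun t k => redS (a t) (S t) (c t) k \in unitmx) 0).
move: nearB; apply: filterS => t [ut At gG _] k _.
by have [] := redS_inv_bound k g_gt0 ut At gG.
Qed.

Lemma near_redS_unit_succ :
  \forall p \near G, redS (a p.1) (S p.1) (c p.1) p.2.+1 \in unitmx.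
Proof.
have [g [s [g_gt0 s_gt0 gs nearB]]] := near_uniformly_bounded.
apply: (@near_prod (fun t k => redS (a t) (S t) (c t) k.+1 \in unitmx) 0).
move: nearB; apply: filterS => t [ut At gG _] k _.
by have [] := redS_inv_bound k.+1 g_gt0 ut At gG.
Qed.

(** The difference is -2 R v v^* R^* with v = D^k c, and v tends to 0. *)
Lemma mxnull_redS_diff : mxnull G (fun p =>
  redS (a p.1) (S p.1) (c p.1) p.2.+1 - redS (a p.1) (S p.1) (c p.1) p.2).
Proof.
have v0 := mxnull_cayleyXc.
have bR : mxbounded G (fun p => resolvent (a p.1)).
  exact: mxbounded_fst (mxbounded_cvg mxcvg_resolvent).
apply: mxnull_eq (mxnullZ (-2) (mxnullMl (mxnullMr bR
  (mxnullMl v0 (mxbounded_adj (mxbounded_null v0)))) (mxbounded_adj bR))).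
apply: nearW => -[t k] /=.
by rewrite [RHS]addrC addKr scaleNr.
Qed.

(** Uses P - P' = P (Q' - Q) P' for the inverses P, P' of Q, Q'. *)
Lemma mxnull_inv_redS_diff : mxnull G (fun p =>
  invmx (redS (a p.1) (S p.1) (c p.1) p.2)
  - invmx (redS (a p.1) (S p.1) (c p.1) p.2.+1)).
Proof.
have bP := mxbounded_inv_redS.
have bP' : mxbounded G
    (fun p => invmx (redS (a p.1) (S p.1) (c p.1) p.2.+1)).
  exact: (mxbounded_snd_succ
    (A := fun t k => invmx (redS (a t) (S t) (c t) k))).
apply: mxnull_eq (mxnullMl (mxnullMr bP mxnull_redS_diff) bP').
move: near_redS_unit near_redS_unit_succ.
apply: filterS2 => p; move: (redS _ _ _ p.2) (redS _ _ _ p.2.+1) => Q Q' uQ uQ'.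
rewrite mulmxBr (mulVmx uQ) mulmxBl mul1mx.
by rewrite -mulmxA mulmxV// mulmx1.
Qed.

(** Telescoping L^* P L - L'^* P' L' into L^* P (L - L') + L^* (P - P') L' + (L - L')^* P' L'. The
    constant block b cancels in L - L', leaving only decaying terms. *)
Lemma mxnull_redF_diff : mxnull G (fun p =>
  redF (a p.1) (S p.1) (b p.1) (c p.1) p.2
  - redF (a p.1) (S p.1) (b p.1) (c p.1) p.2.+1).
Proof.
pose L p := redL (a p.1) (b p.1) (c p.1) p.2.
pose L' p := redL (a p.1) (b p.1) (c p.1) p.2.+1.
have v0 := mxnull_cayleyXc.
have bP := mxbounded_inv_redS.
have bP' : mxbounded G
    (fun p => invmx (redS (a p.1) (S p.1) (c p.1) p.2.+1)).
  exact: (mxbounded_snd_succ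
    (A := fun t k => invmx (redS (a t) (S t) (c t) k))).
have bL : mxbounded G L.
  exact: mxbounded_row_mx (mxbounded_fst (mxbounded_cvg cvg_b))
    (mxbounded_null v0).
have bL' : mxbounded G L'.
  exact: (mxbounded_snd_succ (A := fun t k => redL (a t) (b t) (c t) k)).
have v0' : mxnull G (fun p => cayley (a p.1) ^+ p.2.+1 *m c p.1).
  exact: (mxnull_snd_succ (A := fun t k => cayley (a t) ^+ k *m c t)).
have dL : mxnull G (fun p => L p - L' p).
  apply: mxnull_eq (mxnull_row_mx (@mxnull0 _ _ _ _ n m1)
    (mxnullD v0 (mxnullN v0'))).
  apply: nearW => p.
  by rewrite /L /L' /redL opp_row_mx add_row_mx subrr.
apply: mxnull_eq (mxnullD (mxnullMr (mxboundedM (mxbounded_adj bL) bP) dL)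
  (mxnullD (mxnullMl (mxnullMr (mxbounded_adj bL) mxnull_inv_redS_diff) bL')
    (mxnullMl (mxnullMl (mxnull_adj dL) bP') bL'))).
apply: nearW => p.
rewrite /redF -/(L p) -/(L' p); move: (invmx _) (invmx _) (L p) (L' p).
move=> P P' X Y; rewrite adjmxB !(mulmxBr, mulmxBl).
by rewrite addrA subrKA subrKA.
Qed.

Lemma mxcvg_redF k :
  mxcvg F (fun t => redF (a t) (S t) (b t) (c t) k) (redF a0 S0 b0 c0 k).
Proof.
have cL : mxcvg F (fun t => redL (a t) (b t) (c t) k) (redL a0 b0 c0 k).
  exact: mxcvg_row_mx cvg_b (mxcvg_cayleyXc k).
have [g g_gt0 gG] := gramian0_bound.
have [uQ _] := redS_inv_bound k g_gt0 unit0i adm0 gG.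
exact: mxcvgM (mxcvgM (mxcvg_adj cL) (mxcvg_inv (mxcvg_redS k) uQ)) cL.
Qed.

End Uniform.

(** * Closeness uniform over all indices *)

Section Combine.
Variable C : numClosedFieldType.
Hypothesis archi : forall r e : C, 0 <= r -> r < 1 -> 0 < e ->
  exists K, r ^+ K < e.
Variables (n m1 m2 : nat) (T : Type) (F : set_system T).
Context {FF : Filter F}.
Variables (a S : T -> 'M[C]_n).
Variables (b : T -> 'M[C]_(n, m1)) (c : T -> 'M[C]_(n, m2)).
Variables (a0 S0 : 'M[C]_n) (b0 : 'M[C]_(n, m1)) (c0 : 'M[C]_(n, m2)).
Hypotheses (cvg_a : mxcvg F a a0) (cvg_S : mxcvg F S S0).
Hypotheses (cvg_b : mxcvg F b b0) (cvg_c : mxcvg F c c0).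
Hypothesis adm : \forall t \near F, admissible_form (a t) (S t) (b t) (c t).
Hypothesis adm0 : admissible_form a0 S0 b0 c0.
Hypothesis ctrl0 : row_full (\sum_(k < n) <<(a0 ^+ k *m b0)^T>>)%MS.

Let f t k := redF (a t) (S t) (b t) (c t) k - redF (a t) (S t) (b t) (c t) k.+1.
Let f0 k := redF a0 S0 b0 c0 k - redF a0 S0 b0 c0 k.+1.

(** For large k both differences are below e / 2 separately; the remaining finitely many k are
    covered by continuity at each fixed index. *)
Lemma redF_diff_uniform (e : C) : 0 < e ->
  \forall t \near F, forall k, l1norm (f0 k - f t k) < e.
Proof.
move=> e0; have e2 : 0 < e / 2 by rewrite divr_gt0.
have [[P Q] /= [FP [N _ NQ]] PQ] :=
  mxnull_redF_diff archi cvg_a cvg_S cvg_b cvg_c adm adm0 ctrl0 e2.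
(* The decay for the unperturbed quadruple is the same result for a constant family. *)
have [[P' Q'] /= [FP' [N' _ NQ']] PQ'] :=
  mxnull_redF_diff archi (mxcvg_cst (F := F) a0) (mxcvg_cst S0)
    (mxcvg_cst b0) (mxcvg_cst c0) (nearW _ (fun=> adm0)) adm0 ctrl0 e2.
have small k : \forall t \near F, l1norm (f0 k - f t k) < e.
  have cf : mxcvg F (f ^~ k) (f0 k).
    by apply: mxcvgB; apply: mxcvg_redF.
  by move: (cf _ e0); apply: filterS => t; rewrite -l1normN opprB.
have := near_below (maxn N N') FF small; move: FP FP'; apply: filterS3.
move=> t Pt P't below k; have [|] := ltnP k (maxn N N'); first exact: below.
rewrite geq_max => /andP[Nk N'k].
rewrite (le_lt_trans (l1normD _ _))// l1normN [e]splitr ltrD//.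
  by apply: (PQ' (t, k)); split => //; apply: NQ'.
by apply: (PQ (t, k)); split => //; apply: NQ.
Qed.

Lemma near_regular : \forall t \near F,
  [/\ a t \in unitmx, a t + 'i%:M \in unitmx &
      forall k, redS (a t) (S t) (c t) k \in unitmx].
Proof.
have [g [s [g_gt0 _ _ nearB]]] :=
  near_uniformly_bounded cvg_a cvg_S cvg_b adm adm0 ctrl0.
have ua0 : a0 \in unitmx.
  by case: adm0 => _ S0_gt0 lyap0; apply: admissible_unit lyap0 S0_gt0.
have nearU : \forall t \near F, a t \in unitmx by exact: near_unitmx cvg_a ua0.
move: nearB nearU; apply: filterS2 => t [uai At gG _] ua.
by split => // k; have [] := redS_inv_bound k g_gt0 uai At gG.
Qed.

End Combine.

Local Open Scope complex_scope.

(** * Operator norms and potentials over R[i] *)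

Section Reals.
Variable R : realType.
Local Notation C := (R[i] : numClosedFieldType).

Lemma exprn_small (r e : R) : 0 <= r -> r < 1 -> 0 < e -> exists K, r ^+ K < e.
Proof.
move=> r0 r1 e0.
(* This says that the geometric sum 1 + r + ... + r^(K-1) has K terms, each at least r^K. *)
have bound K : K%:R * (1 - r) * r ^+ K <= 1 - r ^+ K.
  elim: K => [|K IH]; first by rewrite !mul0r expr0 subrr.
  have h : r * (K%:R * (1 - r) * r ^+ K) <= r * (1 - r ^+ K).
    by rewrite ler_wpM2l.
  have h' : (1 - r) * r ^+ K.+1 <= 1 - r.
    by rewrite ler_piMr ?subr_ge0 ?(ltW r1)// exprn_ile1// ltW.
  have -> : K.+1%:R = K%:R + 1 :> R by rewrite -natr1.
  rewrite exprS in h' *; lra.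
have [K hK] : exists K : nat, ((1 - r) * e)^-1 < K%:R.
  exists (Num.bound ((1 - r) * e)^-1); apply: archi_boundP.
  by rewrite invr_ge0 mulr_ge0 ?subr_ge0// ltW.
exists K; have r1' : 0 < 1 - r by rewrite subr_gt0.
have K0 : 0 < K%:R :> R.
  by apply: le_lt_trans hK; rewrite invr_ge0 mulr_ge0// ltW.
have : K%:R * (1 - r) * r ^+ K < K%:R * (1 - r) * e.
  apply: (@le_lt_trans _ _ 1).
    by apply: le_trans (bound K) _; rewrite gerBl exprn_ge0.
  by rewrite -mulrA -ltr_pdivrMr ?mulr_gt0// mul1r.
by rewrite ltr_pM2l// mulr_gt0.
Qed.

(** The order hypotheses force r and e to have zero imaginary part, which reduces the claim to R. *)
Lemma complex_exprn_small (r e : C) : 0 <= r -> r < 1 -> 0 < e ->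
  exists K, r ^+ K < e.
Proof.
case: r e => [r r'] [e e']; rewrite lecE !ltcE /= => /andP[/eqP -> r0].
move=> /andP[_ r1] /andP[/eqP -> e0].
have [K rK] := exprn_small r0 r1 e0; exists K.
by rewrite -[_ +i* _]/(r%:C) -rmorphXn ltcR.
Qed.

Lemma sqrtr_sum_le I (r : seq I) (f : I -> R) : (forall i, 0 <= f i) ->
  Num.sqrt (\sum_(i <- r) f i) <= \sum_(i <- r) Num.sqrt (f i).
Proof.
move=> f0; elim: r => [|i r IH]; first by rewrite !big_nil sqrtr0.
rewrite !big_cons; apply: le_trans (lerD (lexx _) IH).
have sr : 0 <= \sum_(j <- r) f j by apply: sumr_ge0.
rewrite -[leRHS]ger0_norm ?addr_ge0 ?sqrtr_ge0// -sqrtr_sqr ler_wsqrtr//.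
by rewrite sqrrD !sqr_sqrtr// addrAC lerDl mulrn_wge0// mulr_ge0 ?sqrtr_ge0.
Qed.

Lemma entry_le_l2norm n (v : 'cV[R[i]]_n) k : `|v k 0| <= (l2norm v)%:C.
Proof.
rewrite normc_def lecR ler_wsqrtr// (bigD1 k)//= lerDl sumr_ge0// => i _.
by rewrite addr_ge0 ?sqr_ge0.
Qed.

Lemma l2norm_le_l1norm n (v : 'cV[R[i]]_n) :
  (l2norm v)%:C <= l1norm (v : 'M[C]_(n, 1)).
Proof.
apply: (@le_trans _ _ (\sum_k `|v k 0|)); last first.
  by apply: ler_sum => k _; rewrite big_ord1.
under eq_bigr do rewrite normc_def.
rewrite -rmorph_sum lecR sqrtr_sum_le// => k.
by rewrite addr_ge0 ?sqr_ge0.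
Qed.

Lemma l2norm_mul_le p n (A : 'M[R[i]]_(p, n)) (v : 'cV[R[i]]_n) :
  l2norm v <= 1 -> (l2norm (A *m v))%:C <= l1norm (A : 'M[C]_(p, n)).
Proof.
move=> v1; apply: (le_trans (l2norm_le_l1norm _)).
apply: ler_sum => i _; rewrite big_ord1 mxE.
apply: (le_trans (ler_norm_sum _ _ _)); apply: ler_sum => j _.
rewrite normrM ler_piMr// (le_trans (entry_le_l2norm _ _))//.
by rewrite -[1]/(1%:C) lecR.
Qed.

Lemma l1norm_ReE p n (A : 'M[R[i]]_(p, n)) :
  l1norm (A : 'M[C]_(p, n)) = (complex.Re (l1norm (A : 'M[C]_(p, n))))%:C.
Proof. by rewrite RRe_real// ger0_real. Qed.

Lemma opnorm_le_l1norm p n (A : 'M[R[i]]_(p, n)) :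
  (opnorm A)%:C <= l1norm (A : 'M[C]_(p, n)).
Proof.
rewrite l1norm_ReE lecR; apply: ge_sup.
  exists (l2norm (A *m 0)), 0 => //=.
  rewrite /l2norm big1 ?sqrtr0// => k _.
  by rewrite mxE expr0n addr0.
move=> _ [v /= v1 <-]; rewrite -lecR -l1norm_ReE; exact: l2norm_mul_le.
Qed.

(** The entry is a coordinate of the image of a unit basis vector; [l1norm] supplies the upper bound
    that makes the supremum meaningful. *)
Lemma entry_le_opnorm p n (A : 'M[R[i]]_(p, n)) i j :
  `|A i j| <= (opnorm A)%:C.
Proof.
have -> : A i j = (A *m delta_mx j 0 : 'cV_p) i 0 by rewrite -colE mxE.
apply: (le_trans (entry_le_l2norm _ _)); rewrite lecR.
apply: ub_le_sup; last first.
  exists (delta_mx j 0) => //=.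
  rewrite /l2norm (bigD1 j)//= big1 => [|k kj].
    by rewrite mxE !eqxx/= expr1n expr0n/= !addr0 sqrtr1.
  by rewrite mxE (negbTE kj)/= expr0n addr0.
exists (complex.Re (l1norm (A : 'M[C]_(p, n)))) => _ [v /= v1 <-].
by rewrite -lecR -l1norm_ReE; exact: l2norm_mul_le.
Qed.

End Reals.

(** * Reduction of the potential to the Cayley form *)

Section Bridge.
Variable R : realType.
Local Notation C := (R[i] : numClosedFieldType).
Variables (n m1 m2 : nat) (a S0 : 'M[R[i]]_n).
Variables (b : 'M[R[i]]_(n, m1)) (c : 'M[R[i]]_(n, m2)).

Lemma admissible_formP : admissible a S0 b c ->
  admissible_form (C := C) a S0 b c.
Proof.
move=> [[S0h S0pos] lyap0]; split => //.
have [g g0 gS] := @eigenvalues_gt0_qform C n S0 S0h S0pos.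
exact: qform_bound_gt0 g0 gS.
Qed.

Hypotheses (ua : a \in unitmx) (uai : (a : 'M[C]_n) + 'i%:M \in unitmx).
Hypothesis lyap0 : lyap (C := C) a S0 = 'i *: (b *m b ^t* + c *m c ^t*).

(** The signs in j make the two blocks evolve by 1 + i a^-1 = A and 1 - i a^-1 = A D. *)
Lemma Lambda_red k :
  Lambda a b c k = growth (C := C) a ^+ k *m redL (C := C) a b c k.
Proof.
elim: k => [|k IH] /=; first by rewrite /redL expr0 mul1mx mul1mx.
rewrite IH mulmxA -(growthX_comm (C := C)) -!mulmxA scalemxAr -mulmxDr.
rewrite [in RHS]exprSr -[_ * growth _]/(_ *m growth _) -mulmxA.
congr (_ *m _); rewrite /redL cayleyXS !mul_mx_row.
rewrite [growth _ *m (cayley _ *m _)]mulmxA growth_cayley//.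
move: (cayley _ ^+ k *m c) => v.
rewrite /jmx mul_row_block !mulmx1 !mulmx0 addr0 add0r mulmxN mulmx1.
rewrite mul_mx_row scale_row_mx add_row_mx /growth mulmxDl mulmxBl !mul1mx.
by rewrite -!scalemxAl mulmxN scalerN.
Qed.

(** [growth_redS_step] conjugated by A^k, which commutes with a^-1. *)
Lemma Smx_red k : Smx a S0 b c k =
  growth (C := C) a ^+ k *m redS (C := C) a S0 c k
    *m (growth (C := C) a ^+ k) ^t*.
Proof.
elim: k => [|k IH].
  by rewrite expr0 mul1mx adjmx_scalar conjC1 mulmx1.
have step := growth_redS_step (C := C) ua uai (lyap_redS uai lyap0 k).
have invadj : invmx (a ^t*) = (invmx a) ^t* by rewrite trmx_inv map_invmx.
pose G := growth (C := C) a ^+ k.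
have conjG X : invmx a *m (G *m X *m G ^t*) *m (invmx a) ^t* =
    G *m (invmx a *m X *m (invmx a) ^t*) *m G ^t*.
  rewrite !mulmxA -(growthX_comm (C := C)) -!mulmxA -!adjmxM.
  by rewrite -(growthX_comm (C := C)).
transitivity (G *m (growth (C := C) a *m redS (C := C) a S0 c k.+1
    *m (growth (C := C) a) ^t*) *m G ^t*); last first.
  by rewrite exprSr -[_ * growth _]/(_ *m growth _) adjmxM !mulmxA.
rewrite [growth _ *m _ *m _]step /= IH Lambda_red -/G invadj.
rewrite mulmxDr mulmxDl mulmxDr mulmxDl -!conjG; congr (_ + _ + _).
rewrite adjmxM !mulmxA; congr (_ *m _ *m _); rewrite -!mulmxA.
congr (_ *m (_ *m _)); rewrite mulmxA.
(* Here L j L^* becomes b b^* - v v^*. *)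
rewrite /redL /jmx mul_row_block !mulmx1 !mulmx0 addr0 add0r mulmxN mulmx1.
by rewrite tr_row_mx map_col_mx mul_row_col mulNmx -!mulmxA.
Qed.

Hypothesis uS : forall k, redS (C := C) a S0 c k \in unitmx.

Lemma Lambda_Smx_redF k :
  (Lambda a b c k) ^t* *m invmx (Smx a S0 b c k) *m Lambda a b c k =
  redF (C := C) a S0 b c k.
Proof.
rewrite Lambda_red Smx_red /redF.
have uG : growth (C := C) a ^+ k \in unitmx.
  elim: k => [|k IH]; first by rewrite expr0 unitmx1.
  by rewrite exprS unitmx_mul growth_unit.
move: (growth a ^+ k) (redS _ _ _ k) (redL _ _ _ k) uG (uS k) => G Q L uG uQ.
have uGt : G ^t* \in unitmx by rewrite map_unitmx unitmx_tr.
rewrite (invmx_mul (C := C)) ?unitmx_mul ?uG// (invmx_mul (C := C))// adjmxM.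
by rewrite -!mulmxA mulKmx// mulKVmx// !mulmxA.
Qed.

Lemma potential_redF k : potential a S0 b c k =
  jmx R m1 m2 + redF (C := C) a S0 b c k - redF (C := C) a S0 b c k.+1.
Proof. by rewrite /potential !Lambda_Smx_redF. Qed.

End Bridge.

(** * Neighborhoods of a quadruple and the final estimate *)

Section Neighborhoods.
Variable R : realType.
Local Notation C := (R[i] : numClosedFieldType).

Lemma opnorm_ge0 p n (A : 'M[R[i]]_(p, n)) : 0 <= opnorm A.
Proof.
have l20 q : l2norm (0 : 'cV[R[i]]_q) = 0.
  by rewrite /l2norm big1 ?sqrtr0// => k _; rewrite mxE expr0n addr0.
apply: ub_le_sup; last by exists 0; rewrite /= ?mulmx0 l20 ?ler01.
exists (complex.Re (l1norm (A : 'M[C]_(p, n)))) => _ [v /= v1 <-].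
by rewrite -lecR -l1norm_ReE; exact: l2norm_mul_le.
Qed.

Lemma opnorm0 p n : opnorm (0 : 'M[R[i]]_(p, n)) = 0.
Proof.
apply/le_anti; rewrite opnorm_ge0 andbT -lecR.
by apply: le_trans (opnorm_le_l1norm _) _; rewrite (@l1norm0 C).
Qed.

Lemma l1norm_le_opnorm p n (A : 'M[R[i]]_(p, n)) :
  l1norm (A : 'M[C]_(p, n)) <= ((p * n)%:R * opnorm A)%:C.
Proof.
rewrite rmorphM rmorph_nat; apply: l1norm_le_entry => i j.
exact: entry_le_opnorm.
Qed.

Variables (T : Type) (D : set T) (dist : T -> R).

(** Membership in D is built into the basic sets, so that statements near this filter concern only
    nearby admissible quadruples. *)
Definition small_dist : set_system T :=
  filter_from [set d : R | 0 < d] (fun d => [set t | D t /\ dist t < d]).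

Global Instance small_dist_filter : Filter small_dist.
Proof.
apply: filter_from_filter; first by exists 1 => /=.
move=> d d' /= d0 d'0; exists (Num.min d d'); first by rewrite lt_min d0.
by move=> t /= [Dt]; rewrite lt_min => /andP[].
Qed.

Lemma small_dist_mxcvg p n (u : T -> 'M[R[i]]_(p, n)) u0 :
  (forall t, opnorm (u0 - u t) <= dist t) ->
  mxcvg (C := C) small_dist u u0.
Proof.
move=> udist [e e']; rewrite ltcE /= => /andP[/eqP -> e0].
have N0 : 0 < (p * n)%:R + 1 :> R by rewrite ltr_wpDl.
exists (e / ((p * n)%:R + 1)) => /=; first by rewrite divr_gt0.
move=> t [_]; rewrite ltr_pdivlMr// mulrC => te.
rewrite -(@l1normN C) opprB; apply: le_lt_trans (l1norm_le_opnorm _) _.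
rewrite -[_ +i* _]/(e%:C) ltcR; apply: le_lt_trans te.
by rewrite ler_pM ?opnorm_ge0 ?lerDl.
Qed.

End Neighborhoods.

Theorem theorem4p12 (R : realType) (n m1 m2 : nat) (alpha S0 : 'M[R[i]]_n)
    (th1 : 'M[R[i]]_(n, m1)) (th2 : 'M[R[i]]_(n, m2))
    (adm : admissible alpha S0 th1 th2)
    (ctrl : controllable alpha th1)
    (hi : ~ sigma alpha 'i) :
  forall eps : R, 0 < eps ->
  exists2 delta : R, 0 < delta &
  forall (alpha' S0' : 'M[R[i]]_n)
         (th1' : 'M[R[i]]_(n, m1)) (th2' : 'M[R[i]]_(n, m2)),
    admissible alpha' S0' th1' th2' ->
    opnorm (alpha - alpha') + opnorm (S0 - S0')
      + opnorm (th1 - th1') + opnorm (th2 - th2') < delta ->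
    (ereal_sup
       [set (opnorm (potential alpha S0 th1 th2 k
                     - potential alpha' S0' th1' th2' k))%:E | k in [set: nat]]
     < eps%:E)%E.
Proof.
move=> eps eps_gt0; pose C : numClosedFieldType := R[i].
pose T := ('M[C]_n * 'M[C]_n * 'M[C]_(n, m1) * 'M[C]_(n, m2))%type.
pose a (t : T) := t.1.1.1; pose S (t : T) := t.1.1.2.
pose b (t : T) := t.1.2; pose c (t : T) := t.2.
pose dist (t : T) : R := opnorm (alpha - a t) + opnorm (S0 - S t)
  + opnorm (th1 - b t) + opnorm (th2 - c t).
pose F := small_dist [set t : T | admissible (a t) (S t) (b t) (c t)] dist.
have FF : Filter F by exact: small_dist_filter.
have ge0 := @opnorm_ge0 R.
have cvg_a : mxcvg F a alpha.
  by apply: small_dist_mxcvg => t; rewrite /dist -!addrA lerDl !addr_ge0.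
have cvg_S : mxcvg F S S0.
  apply: small_dist_mxcvg => t; rewrite /dist -!addrA addrCA lerDl !addr_ge0//.
have cvg_b : mxcvg F b th1.
  by apply: small_dist_mxcvg => t; rewrite /dist addrAC lerDr !addr_ge0.
have cvg_c : mxcvg F c th2.
  by apply: small_dist_mxcvg => t; rewrite /dist lerDr !addr_ge0.
have admF : \forall t \near F, admissible_form (a t) (S t) (b t) (c t).
  by exists 1 => //= t [At _]; apply: admissible_formP.
have adm0 : admissible_form (C := C) alpha S0 th1 th2.
  exact: admissible_formP.
(* Passing to the supremum weakens a strict bound, so eps / 2 is aimed at. *)
have e2 : 0 < (eps / 2)%:C :> C by rewrite ltcR divr_gt0.
have near_close := redF_diff_uniform (@complex_exprn_small R)
  cvg_a cvg_S cvg_b cvg_c admF adm0 ctrl e2.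
have near_reg := near_regular cvg_a cvg_S cvg_b admF adm0 ctrl.
have near_both := @filterI T F FF _ _ (near_close FF) (near_reg FF).
case: near_both => d d_gt0 ball; exists d => // alpha' S0' th1' th2' adm' dlt.
(* The unperturbed quadruple lies in its own neighborhood, so its invertibility properties come from
   the same near statement. *)
have t0 : dist (alpha, S0, th1, th2) < d.
  by rewrite /dist /= !subrr !opnorm0 !addr0.
have [_ [ua uai uS]] := ball (alpha, S0, th1, th2) (conj adm t0).
have [close [ua' uai' uS']] := ball (alpha', S0', th1', th2') (conj adm' dlt).
cbn in ua, uai, uS, ua', uai', uS', close.
have [_ _ lyap0] := adm0; have [_ _ lyap'] := admissible_formP adm'.
apply: (@le_lt_trans _ _ (eps / 2)%:E); last first.
  by rewrite lte_fin ltr_pdivrMr// ltr_pMr// ltr1n.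
apply: ge_ereal_sup => _ [k _ <-]; rewrite lee_fin -lecR.
apply: le_trans (opnorm_le_l1norm _) _; apply: ltW.
have -> := potential_redF ua uai lyap0 uS k.
have -> := potential_redF ua' uai' lyap' uS' k.
rewrite -[X in X - _]addrA -[X in _ - X]addrA opprD addrACA subrr add0r.
exact: close.
Qed.
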